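(* Let $\mathbb P(\mathcal S)=\bigoplus_{K\subseteq\mathbb I}\Bbbk[X_1^{\pm1},\dots,X_n^{\pm1}]^{W_K}\mathbf v^{(K)}$, where $\mathbf v^{(K)}$ is a formal copy of $\mathbf v$ indexing the summand. There is a faithful representation $\rho$ of the affine Schur algebra $\mathcal S$ on $\mathbb P(\mathcal S)$ in which, for $J,K\subseteq\mathbb I$ and $d\in D_{K,J}$, the basis element $\mathbf b^d_{K,J}$ acts by zero on the summands indexed by $J'\ne J$ and, for $f\in\Bbbk[X_1^{\pm1},\dots,X_n^{\pm1}]^{W_J}$, $$\rho(\mathbf b^d_{K,J})\,f\mathbf v^{(J)}=\sum_{a\in D^K_{\emptyset,K\cap dJ}}T_aT_d\cdot f\mathbf v^{(K)},$$ where the right-hand side is computed in the $\mathcal H$-module $\Bbbk[X_1^{\pm1},\dots,X_n^{\pm1}]\mathbf v$ and placed in the summand indexed by $K$.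
   Context: Setting: $q$ is the residue field cardinality of a finite extension of $\mathbb Q_p$, $\Bbbk$ algebraically closed of characteristic $\ne p$ with $q\ne 1$ in $\Bbbk$, $n\ge 2$. $\mathcal H$: unital $\Bbbk$-algebra generated by $T_1,\dots,T_{n-1},X_1^{\pm1},\dots,X_n^{\pm1}$ with $(T_i-q)(T_i+1)=0$, braid relations, commuting Laurent $X_j$, $T_iX_j=X_jT_i$ ($j\notin\{i,i+1\}$), $T_iX_iT_i=qX_{i+1}$. $\mathbb I=\{s_1,\dots,s_{n-1}\}\subseteq\mathfrak S_n$, $W_J=\langle J\rangle$, $T_w=T_{i_1}\cdots T_{i_r}$ for reduced $w=s_{i_1}\cdots s_{i_r}\in\mathfrak S_n$, $\mathbf v_J=\sum_{w\in W_J}T_w$. Extended affine Weyl group: $\mathrm W=\mathfrak S_n\ltimes\mathfrak X$, $\mathfrak X$ the free abelian group on $X_1,\dots,X_n$ with $wX_iw^{-1}=X_{w(i)}$. Put $s_0=s_{n-1}\cdots s_2s_1s_2\cdots s_{n-1}X_1X_n^{-1}$, $\tau=s_{n-1}\cdots s_1X_1$; every $w\in\mathrm W$ is uniquely $x\tau^j$ with $x$ in the Coxeter group generated by $s_0,\dots,s_{n-1}$, $j\in\mathbb Z$; $l(w)$ is the Coxeter length of $x$ and $T_w=T_{s_{i_1}}\cdots T_{s_{i_r}}T_\tau^j$ for a reduced $x=s_{i_1}\cdots s_{i_r}$, with $T_{s_i}=T_i$ ($i\ge1$), $T_{s_0}=q^{n-1}X_1^{-1}X_n(T_{n-1}\cdots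 T_2T_1T_2\cdots T_{n-1})^{-1}$, $T_\tau=q^{-(n-1)/2}T_{n-1}\cdots T_1X_1$. For $J,K\subseteq\mathbb I$, $D_{K,J}$ is the set of minimal-length elements of the double cosets $W_K\backslash\mathrm W/W_J$. For $w\in\mathrm W$, $\mathbf b^w_{K,J}\in\mathrm{Hom}_{\mathcal H}(\mathbf v_J\mathcal H,\mathbf v_K\mathcal H)$ is the right-module homomorphism with $\mathbf v_J\mapsto\sum_{v\in W_KwW_J}T_v$. $\mathcal S=\mathrm{End}_{\mathcal H}(\bigoplus_{J\subseteq\mathbb I}\mathbf v_J\mathcal H)$ (right modules), product = composition; the elements $\mathbf b^d_{K,J}$ ($J,K\subseteq \mathbb I$, $d\in D_{K,J}$) form a basis of $\mathcal S$. For $d\in D_{K,J}$, $K\cap dJ=\{s\in K\mid d^{-1}sd\in J\}$, and for $L\subseteq K$, $D^K_{\emptyset,L}$ is the set of minimal-length representatives of the left cosets $W_K/W_L$. $\Bbbk[X^{\pm1}]\mathbf v$ is the $\mathcal H$-module on which $X_j$ act by multiplication and $T_i\cdot f\mathbf v=qf\mathbf v-\frac{qX_i-X_{i+1}}{X_i-X_{i+1}}(f-s_i(f))\mathbf v$, where $s_i(f)$ swaps $X_i,X_{i+1}$; $W_K$ acts on Laurent polynomials by permuting variables. *)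

(* Defs.v *)
From HB Require Import structures.
From mathcomp Require Import all_boot all_order all_algebra all_fingroup.
From mathcomp Require Import finmap.
From mathcomp.multinomials Require Import monalg.
From Stdlib Require Import ClassicalEpsilon.

Set Implicit Arguments.
Unset Strict Implicit.
Unset Printing Implicit Defensive.

Import GRing.Theory.
Local Open Scope ring_scope.

Definition pb (P : Prop) : bool :=
  if excluded_middle_informative P then true else false.

(* Throughout, n = m.+2 (i.e. n >= 2).  Positions 1..n of the paper are the   *)
(* ordinals 0..n-1 of 'I_n; the simple reflection s_{i+1} (i : 'I_m.+1,       *)
(* i.e. i = 0..n-2) swaps the positions i and i+1.  Subsets J of             *)
(* I = {s_1,...,s_{n-1}} are encoded as {set 'I_m.+1}.                        *)
Section Weyl.
Variable m : nat.
Local Notation n := m.+2.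

Definition Zn := {ffun 'I_n -> int}.
Definition ei (j : 'I_n) : Zn := [ffun i => ((i == j) : nat)%:Z].

(* permutations act on Z^n: (sigma lambda)(j) = lambda(sigma^-1 j), so that
   sigma X^lambda sigma^-1 = X^(sigma lambda), i.e. sigma X_i sigma^-1 = X_sigma(i) *)
Definition permv (s : {perm 'I_n}) (l : Zn) : Zn := [ffun j => l ((s^-1)%g j)].

(* Extended affine Weyl group W = S_n |x X: the pair (lambda, sigma)
   stands for X^lambda sigma. The permutation component is composed as
   functions: (s2 * s1)%g is the function s1 o s2 in mathcomp. *)
Definition Wt := (Zn * {perm 'I_n})%type.
Definition wone : Wt := (0, 1%g).
Definition wmul (w1 w2 : Wt) : Wt :=
  (w1.1 + permv w1.2 w2.1, (w2.2 * w1.2)%g).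
Definition winv (w : Wt) : Wt := (- permv (w.2^-1)%g w.1, (w.2^-1)%g).
Definition wprod (s : seq Wt) : Wt := foldr wmul wone s.
Definition wpowz (w : Wt) (j : int) : Wt :=
  match j with
  | Posz a => iter a (wmul w) wone
  | Negz a => iter a.+1 (wmul (winv w)) wone
  end.
Definition fW (s : {perm 'I_n}) : Wt := (0, s).
Definition eX (l : Zn) : Wt := (l, 1%g).

Definition sfin (i : 'I_m.+1) : {perm 'I_n} :=
  tperm (widen_ord (leqnSn _) i) (lift ord0 i).

Definition word0 : seq 'I_m.+1 := rev (enum 'I_m.+1) ++ behead (enum 'I_m.+1).

Definition s0 : Wt :=
  wmul (wprod (map (fun i => fW (sfin i)) word0)) (eX (ei ord0 - ei ord_max)).
Definition tau : Wt :=
  wmul (wprod (map (fun i => fW (sfin i)) (rev (enum 'I_m.+1)))) (eX (ei ord0)).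

Definition saff (i : 'I_n) : Wt :=
  if unlift ord0 i is Some j then fW (sfin j) else s0.

Definition aword (s : seq 'I_n) (j : int) : Wt :=
  wmul (wprod (map saff s)) (wpowz tau j).
Definition areduced (w : Wt) (s : seq 'I_n) (j : int) : Prop :=
  aword s j = w /\ forall s' j', aword s' j' = w -> (size s <= size s')%N.
Definition alen_le (w w' : Wt) : Prop :=
  forall s' j', aword s' j' = w' ->
    exists s j, aword s j = w /\ (size s <= size s')%N.

Definition fword (s : seq 'I_m.+1) : {perm 'I_n} :=
  (wprod (map (fun i => fW (sfin i)) s)).2.
Definition freduced (w : {perm 'I_n}) (s : seq 'I_m.+1) : Prop :=
  fword s = w /\ forall s', fword s' = w -> (size s <= size s')%N.
Definition flen_le (w w' : {perm 'I_n}) : Prop :=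
  forall s', fword s' = w' -> exists s, fword s = w /\ (size s <= size s')%N.

Definition WK (K : {set 'I_m.+1}) : {set {perm 'I_n}} :=
  <<[set sfin i | i in K]>>%g.

Definition Dcos (K J : {set 'I_m.+1}) (d : Wt) : Prop :=
  forall u v, u \in WK K -> v \in WK J -> alen_le d (wmul (wmul (fW u) d) (fW v)).

Definition KdJ (K J : {set 'I_m.+1}) (d : Wt) : {set 'I_m.+1} :=
  [set i in K | [exists j in J,
       wmul (winv d) (wmul (fW (sfin i)) d) == fW (sfin j)]].

Definition Dmin (K L : {set 'I_m.+1}) (a : {perm 'I_n}) : Prop :=
  a \in WK K /\ forall v, v \in WK L -> flen_le a ((v * a)%g).

Definition dcoset (K J : {set 'I_m.+1}) (d : Wt) : seq Wt :=
  undup [seq wmul (wmul (fW u) d) (fW v) | u <- enum (WK K), v <- enum (WK J)].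

End Weyl.

Section Hecke.
Variable m : nat.
Local Notation n := m.+2.
Variable k : fieldType.
Variable q : nat.

Definition hecke_rels (A : algType k) (T : 'I_m.+1 -> A) (X Xi : 'I_n -> A)
  : Prop :=
  (forall i, (T i - q%:R) * (T i + 1) = 0) /\
  (forall i j : 'I_m.+1, (i.+1 < j)%N || (j.+1 < i)%N -> T i * T j = T j * T i) /\
  (forall i j : 'I_m.+1, (j : nat) = i.+1 -> T i * T j * T i = T j * T i * T j) /\
  (forall j, X j * Xi j = 1 /\ Xi j * X j = 1) /\
  (forall j j', X j * X j' = X j' * X j) /\
  (forall (i : 'I_m.+1) (j : 'I_n), j != widen_ord (leqnSn _) i ->
     j != lift ord0 i -> T i * X j = X j * T i) /\
  (forall i : 'I_m.+1,
     T i * X (widen_ord (leqnSn _) i) * T i = q%:R * X (lift ord0 i)).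

Definition hecke_generated (H : algType k) (T : 'I_m.+1 -> H) (X Xi : 'I_n -> H)
  : Prop :=
  forall P : H -> Prop, P 1 -> (forall i, P (T i)) -> (forall j, P (X j)) ->
    (forall j, P (Xi j)) -> (forall a x y, P x -> P y -> P (a *: x + y)) ->
    (forall x y, P x -> P y -> P (x * y)) -> forall h, P h.

Definition hecke_universal (H : algType k) (T : 'I_m.+1 -> H) (X Xi : 'I_n -> H)
  : Prop :=
  forall (B : algType k) (t : 'I_m.+1 -> B) (x xi : 'I_n -> B),
    hecke_rels t x xi ->
    exists f : H -> B,
      (forall a u v, f (a *: u + v) = a *: f u + f v) /\
      (forall u v, f (u * v) = f u * f v) /\
      f 1 = 1 /\
      (forall i, f (T i) = t i) /\
      (forall j, f (X j) = x j) /\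
      (forall j, f (Xi j) = xi j).

Variable H : algType k.
Variables (T : 'I_m.+1 -> H) (X Xi : 'I_n -> H).
Variable sq : k. (* a fixed square root of q in k *)

Definition Tinv (i : 'I_m.+1) : H := (q%:R : k)^-1 *: (T i - (q%:R - 1)).

Definition Ts0 : H :=
  (q%:R : k) ^+ m.+1 *: (Xi ord0 * X ord_max * \prod_(i <- rev (word0 m)) Tinv i).
Definition Ttau : H :=
  sq^-1 ^+ m.+1 *: (\prod_(i <- rev (enum 'I_m.+1)) T i * X ord0).
Definition Ttaui : H :=
  sq ^+ m.+1 *: (Xi ord0 * \prod_(i <- enum 'I_m.+1) Tinv i).
Definition Ttaupow (j : int) : H :=
  match j with Posz a => Ttau ^+ a | Negz a => Ttaui ^+ a.+1 end.
Definition Tgen (i : 'I_n) : H :=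
  if unlift ord0 i is Some j then T j else Ts0.

Definition Taff (w : Wt m) : H :=
  match excluded_middle_informative
          (exists sj : seq 'I_n * int, areduced w sj.1 sj.2) with
  | left e => let sj := proj1_sig (constructive_indefinite_description _ e) in
              \prod_(i <- sj.1) Tgen i * Ttaupow sj.2
  | right _ => 0
  end.

Definition Tfin (w : {perm 'I_n}) : H :=
  match excluded_middle_informative (exists s, freduced w s) with
  | left e => \prod_(i <- proj1_sig (constructive_indefinite_description _ e)) T i
  | right _ => 0
  end.

Definition vJ (J : {set 'I_m.+1}) : H := \sum_(w in WK J) Tfin w.

(* ---- the Schur algebra S = End_H (oplus_J v_J H) (right modules) ---- *)
(* An element of oplus_J v_J H is a family x with x J in v_J H. *)
Definition Fam := {set 'I_m.+1} -> H.
Definition inM (x : Fam) : Prop := forall J, exists h, x J = vJ J * h.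
(* right H-module endomorphisms (k-linearity follows, k being central) *)
Definition isS (phi : Fam -> Fam) : Prop :=
  [/\ forall x, inM x -> inM (phi x),
      forall x y, inM x -> inM y ->
        phi (fun J => x J + y J) = (fun K => phi x K + phi y K) &
      forall x h, inM x -> phi (fun J => x J * h) = (fun K => phi x K * h)].
Definition eJ (J : {set 'I_m.+1}) (u : H) : Fam :=
  fun J' => if J' == J then u else 0.
Definition is_b (K J : {set 'I_m.+1}) (d : Wt m) (phi : Fam -> Fam) : Prop :=
  phi (eJ J (vJ J)) = eJ K (\sum_(v <- dcoset K J d) Taff v) /\
  forall J', J' != J -> phi (eJ J' (vJ J')) = (fun _ => 0).

End Hecke.

(* Laurent polynomials k[X_1^{+-1},...,X_n^{+-1}] = group algebra k[Z^n]     *)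
Section Laurent.
Variable m : nat.
Local Notation n := m.+2.
Variable k : fieldType.

Definition Laur := {malg k[Zn m]}.
Definition Lmul (f g : Laur) : Laur :=
  \sum_(l <- msupp f) \sum_(l' <- msupp g) << f@_l * g@_l' *g (l + l') >>.
Definition xv (j : 'I_n) : Laur := << 1 *g ei j >>.
Definition xvi (j : 'I_n) : Laur := << 1 *g - ei j >>.
Definition permL (s : {perm 'I_n}) (f : Laur) : Laur :=
  \sum_(l <- msupp f) << f@_l *g permv s l >>.
Definition invariant (K : {set 'I_m.+1}) (f : Laur) : Prop :=
  forall s, s \in WK K -> permL s f = f.

Variable q : nat.
Variable H : algType k.
Variables (T : 'I_m.+1 -> H) (X Xi : 'I_n -> H).

(* pi : H -> End_k(k[X^{+-1}]) is the H-module k[X^{+-1}] v: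
   X_j act by multiplication, and
   T_i f = q f - (q X_i - X_{i+1}) / (X_i - X_{i+1}) (f - s_i f),
   stated after multiplying by X_i - X_{i+1} (k[X^{+-1}] is a domain). *)
Definition polyrep (pi : H -> Laur -> Laur) : Prop :=
  (forall a u v f, pi (a *: u + v) f = a *: pi u f + pi v f) /\
  (forall u v f, pi (u * v) f = pi u (pi v f)) /\
  (forall f, pi 1 f = f) /\
  (forall u a f g, pi u (a *: f + g) = a *: pi u f + pi u g) /\
  (forall j f, pi (X j) f = Lmul (xv j) f) /\
  (forall j f, pi (Xi j) f = Lmul (xvi j) f) /\
  (forall i f,
        Lmul (xv (widen_ord (leqnSn _) i) - xv (lift ord0 i)) (pi (T i) f) =
        Lmul (xv (widen_ord (leqnSn _) i) - xv (lift ord0 i)) ((q%:R : k) *: f)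
        - Lmul ((q%:R : k) *: xv (widen_ord (leqnSn _) i) - xv (lift ord0 i))
               (f - permL (sfin i) f)).

(* P(S) = oplus_K k[X^{+-1}]^{W_K} v^(K), as families p with p K invariant *)
Definition PF := {set 'I_m.+1} -> Laur.
Definition inP (p : PF) : Prop := forall K, invariant K (p K).

Variable sq : k.

Definition rho_b (pi : H -> Laur -> Laur) (K J : {set 'I_m.+1}) (d : Wt m)
  (p : PF) : PF :=
  fun K' => if K' == K then
      \sum_(a in WK K | pb (Dmin K (KdJ K J d) a))
         pi (Tfin T a * Taff q T X Xi sq d) (p J)
    else 0.

End Laurent.

(* Main.v *)
Require Import Defs.
From HB Require Import structures.
From mathcomp Require Import all_boot all_order all_algebra all_fingroup.
From mathcomp Require Import finmap zify.
From mathcomp.multinomials Require Import monalg.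
From mathcomp.multinomials Require mpoly.
From Stdlib Require Import ClassicalEpsilon FunctionalExtensionality.
Import Order.TTheory GRing.Theory Num.Theory.
Set Implicit Arguments.
Unset Strict Implicit.
Unset Printing Implicit Defensive.
Local Open Scope ring_scope.

(* An endomorphism phi of the direct sum of the v_J H is a matrix of elements *)
(* h_KJ of v_K H with h_KJ T_i = q h_KJ for i in J.  In the Bernstein basis   *)
(* this forces h_KJ = h'_KJ v_J, and phi acts by the matrix (h'_KJ) on the    *)
(* W_J-invariant Laurent polynomials, which are the f with T_i f = q f for i  *)
(* in J.                                                                      *)
(* The choice of h' is irrelevant: if h' v_J = 0 and f is W_J-invariant, take *)
(* z <> 0 in the image of v_J and let N be its norm, the product of all       *)
(* permutations of z.  Then N f = v_J g for some g, and N is central, so      *)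
(* N (h' f) = h' v_J g = 0.  Faithfulness follows from that of the polynomial *)
(* representation of H, where T_w is triangular with respect to length over   *)
(* the permutations, which are linearly independent over Laurent polynomials. *)
(* For b^d one needs that the sum of the T_v, v in W_K d W_J, is              *)
(* (sum_a T_a T_d) v_J.  Elements of the extended affine Weyl group are viewed*)
(* as affine permutations of the integers; descents are inversions of         *)
(* consecutive integers, which yields Matsumoto's theorem and the unique      *)
(* length-additive factorisations v = a d b.                                  *)

(** * The extended affine Weyl group as affine permutations *)

(** With [entry phi K J] written as a left factor times [vJ J] ([entry_factor], from [eigen_vJ]),
    the theorem becomes matrix algebra over the polynomial representation. Two left factors of one
    entry differ by a left annihilator of [vJ J], and such an annihilator kills the [W_J]-invariants
    ([ann_vJ]). So [schur_act] may be computed with any convenient factors ([schur_actE]): sums, the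
    matrix products of [entry_comp], the identity matrix. The image consists of invariants because
    entries in row [K] are left eigenvectors of the [T i] with [i] in [K] ([schur_act_inv]).

    Faithfulness is tested on the invariants [pi (vJ J) g]: a left factor acts on them as the entry
    itself acts on [g], and [pi_faithful] applies. Both [eigen_vJ] and [pi_faithful] rest on the
    Bernstein basis: the products of Laurent polynomials and [Tfin s] span ([spanned_all]), and they
    act independently ([comb_faithful]), by the triangularity of [Tfin_triangular] and the
    independence of permutations in [permL_indep].

    The formula for the basis elements is [sum_dcoset]. It combines the unique factorisations of
    [dcoset_perm], the additivity of lengths in [alen_incr_mul], and [Taff_mul], which needs the
    independence of the reduced word ([matsumoto]). *)

Section AffinePermutations.
Variable m : nat.
Local Notation n := m.+2.
Implicit Types (w x y d : Wt m) (s t : {perm 'I_n}) (l : Zn m).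

Lemma permvE s l j : permv s l j = l ((s^-1)%g j).
Proof. by rewrite ffunE. Qed.

Lemma permv1 l : permv 1%g l = l.
Proof. by apply/ffunP => j; rewrite permvE invg1 perm1. Qed.

Lemma permvM s t l : permv (s * t)%g l = permv t (permv s l).
Proof. by apply/ffunP => j; rewrite !permvE invMg permM. Qed.

Lemma permvD s l l' : permv s (l + l') = permv s l + permv s l'.
Proof. by apply/ffunP => j; rewrite !(permvE, ffunE). Qed.

Lemma permvN s l : permv s (- l) = - permv s l.
Proof. by apply/ffunP => j; rewrite !(permvE, ffunE). Qed.

Lemma permv0 s : permv s 0 = 0.
Proof. by apply/ffunP => j; rewrite !(permvE, ffunE). Qed.

Lemma wmulA : associative (@wmul m).
Proof.
move=> [l1 s1] [l2 s2] [l3 s3]; rewrite /wmul /=.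
by rewrite permvD addrA permvM mulgA.
Qed.

Lemma wmul1w : left_id (wone m) (@wmul m).
Proof. by case=> l s; rewrite /wmul /= permv1 add0r mulg1. Qed.

Lemma wmulw1 : right_id (wone m) (@wmul m).
Proof. by case=> l s; rewrite /wmul /= permv0 addr0 mul1g. Qed.

Lemma wmulVw w : wmul (winv w) w = wone m.
Proof. by case: w => l s; rewrite /wmul /winv /= addNr mulgV. Qed.

Lemma wmulwV w : wmul w (winv w) = wone m.
Proof.
case: w => l s; rewrite /wmul /winv /= permvN -permvM mulVg permv1.
by rewrite subrr.
Qed.

Lemma wmulKw w x : wmul (winv w) (wmul w x) = x.
Proof. by rewrite wmulA wmulVw wmul1w. Qed.

Lemma wmulKVw w x : wmul w (wmul (winv w) x) = x.
Proof. by rewrite wmulA wmulwV wmul1w. Qed.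

Lemma wmulwK w x : wmul (wmul x w) (winv w) = x.
Proof. by rewrite -wmulA wmulwV wmulw1. Qed.

Lemma wmulIw w x y : wmul w x = wmul w y -> x = y.
Proof. by move=> e; rewrite -[x](wmulKw w) e wmulKw. Qed.

Lemma wmulwI w x y : wmul x w = wmul y w -> x = y.
Proof. by move=> e; rewrite -[x](wmulwK w) e wmulwK. Qed.

Lemma winv_uniq x y : wmul x y = wone m -> winv x = y.
Proof. by move=> e; rewrite -[y](wmulKw x) e wmulw1. Qed.

Lemma winvK : involutive (@winv m).
Proof. by move=> w; apply: winv_uniq; rewrite wmulVw. Qed.

Lemma winvM x y : winv (wmul x y) = wmul (winv y) (winv x).
Proof.
by apply: winv_uniq; rewrite -wmulA (wmulA y) wmulwV wmul1w wmulwV.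
Qed.

Lemma fWM s t : wmul (fW s) (fW t) = fW (t * s)%g.
Proof. by rewrite /wmul /fW /= permv0 addr0. Qed.

Lemma winv_fW s : winv (fW s) = fW (s^-1)%g.
Proof. by rewrite /winv /fW /= permv0 oppr0. Qed.

Lemma wprod_fW (r : seq 'I_m.+1) :
  wprod [seq fW (sfin i) | i <- r] = fW (fword r).
Proof.
rewrite /fword; elim: r => //= i r IH; rewrite IH /wmul /fW /=.
by rewrite permv0 addr0.
Qed.

Lemma fword_cons i r : @fword m (i :: r) = (fword r * sfin i)%g.
Proof. by []. Qed.

Lemma fword_cat r1 r2 : @fword m (r1 ++ r2) = (fword r2 * fword r1)%g.
Proof.
by elim: r1 => [|i r1 IH] /=; rewrite ?mulg1 // !fword_cons IH mulgA.
Qed.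

Lemma sfinV (i : 'I_m.+1) : ((sfin i)^-1)%g = sfin i.
Proof. exact: tpermV. Qed.

Lemma sfinK (i : 'I_m.+1) : (sfin i * sfin i)%g = 1%g.
Proof. exact: tperm2. Qed.

Lemma fword_rev r : @fword m (rev r) = ((fword r)^-1)%g.
Proof.
elim: r => [|i r IH]; first by rewrite invg1.
by rewrite rev_cons -cats1 fword_cat IH !fword_cons mul1g invMg sfinV.
Qed.

(* [Wt] acts on the integers by affine permutations, [(a, c)] standing for   *)
(* the integer [a + n c]; the sign makes [tau] the shift by [-1].            *)
Definition pact w (p : 'I_n * int) : 'I_n * int := (w.2 p.1, p.2 - w.1 (w.2 p.1)).
Definition vl (p : 'I_n * int) : int := (p.1 : nat)%:Z + n%:Z * p.2.

Lemma pactM x y p : pact (wmul x y) p = pact x (pact y p).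
Proof.
by case: p => a c; rewrite /pact /= !(permM, ffunE) permK opprD addrA addrAC.
Qed.

Lemma pact1 p : pact (wone m) p = p.
Proof. by case: p => a c; rewrite /pact /= perm1 !ffunE subr0. Qed.

Lemma pactK w : cancel (pact w) (pact (winv w)).
Proof. by move=> p; rewrite -pactM wmulVw pact1. Qed.

Lemma pactKV w : cancel (pact (winv w)) (pact w).
Proof. by move=> p; rewrite -pactM wmulwV pact1. Qed.

Lemma vl_inj : injective vl.
Proof.
move=> [a c] [b e]; rewrite /vl /= => H.
have la := ltn_ord a; have lb := ltn_ord b.
have E : c = e by nia.
have Eab : a = b by apply: val_inj => /=; nia.
by rewrite E Eab.
Qed.

Lemma vl_pact w a c : vl (pact w (a, c)) = vl (pact w (a, 0)) + n%:Z * c.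
Proof. by rewrite /vl /pact /=; lia. Qed.

Lemma pact_inj w w' : (forall a, pact w (a, 0) = pact w' (a, 0)) -> w = w'.
Proof.
case: w w' => [l s] [l' s'] H.
have Es : s = s' by apply/permP => a; case: (H a).
rewrite -Es in H *; congr (_, _); apply/ffunP => j.
by case: (H ((s^-1)%g j)) => /=; rewrite permKV !sub0r => /oppr_inj.
Qed.

Lemma vl_pact_inj w w' : (forall p, vl (pact w p) = vl (pact w' p)) -> w = w'.
Proof. by move=> H; apply: pact_inj => a; apply: vl_inj. Qed.

Lemma lo_neq_hi (i : 'I_m.+1) : widen_ord (leqnSn m.+1) i != lift ord0 i.
Proof. by rewrite -val_eqE /= /bump /= add1n neq_ltn ltnSn. Qed.

Lemma sfin_lo (i : 'I_m.+1) : sfin i (widen_ord (leqnSn m.+1) i) = lift ord0 i.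
Proof. exact: tpermL. Qed.

Lemma sfin_hi (i : 'I_m.+1) : sfin i (lift ord0 i) = widen_ord (leqnSn m.+1) i.
Proof. exact: tpermR. Qed.

Lemma sfinE (i : 'I_m.+1) (a : 'I_n) :
  (sfin i a : nat) = if (a : nat) == i then i.+1 else if (a : nat) == i.+1 then i : nat else a.
Proof.
rewrite /sfin permE /= -!val_eqE /= /bump /= add1n.
by case: ifP => //= _; case: ifP.
Qed.

Lemma take_enum_ord_rcons (k : nat) (lk : (k < m.+1)%N) :
  take k.+1 (enum 'I_m.+1) = rcons (take k (enum 'I_m.+1)) (Ordinal lk).
Proof.
rewrite (take_nth (Ordinal lk)) ?size_enum_ord //; congr (rcons _ _).
by apply: val_inj => /=; rewrite nth_enum_ord.
Qed.

Lemma fword_rev_take (k : nat) (a : 'I_n) : (k <= m.+1)%N ->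
  (fword (rev (take k (enum 'I_m.+1))) a : nat) =
  if (a : nat) == 0%N then k else if (a <= k)%N then a.-1 else a.
Proof.
elim: k => [|k IH] lk.
  by rewrite take0 /fword /= perm1; case: (a : nat) => // b.
rewrite (take_enum_ord_rcons lk) rev_rcons fword_cons permM sfinE IH //; last exact: ltnW.
rewrite /=; case: (eqVneq (a : nat) 0%N) => a0; first by rewrite eqxx.
by case: (leqP a k) => lak; repeat case: ifP; lia.
Qed.

Definition cyc : {perm 'I_n} := fword (rev (enum 'I_m.+1)).

Lemma cycE (a : 'I_n) : cyc a = ord_pred a.
Proof.
apply: val_inj; rewrite /= /cyc -[enum _]take_size size_enum_ord.
rewrite fword_rev_take //; have la := ltn_ord a.
case: eqP => [->|/eqP a0]; first by rewrite modn_small //.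
rewrite -ltnS la; have -> : (a + n).-1 = (a.-1 + n)%N by lia.
by rewrite modnDr modn_small //; lia.
Qed.

Lemma tauE : tau m = (ei ord_max, cyc).
Proof.
rewrite /tau wprod_fW /wmul /fW /eX /= mul1g add0r; congr (_, _).
apply/ffunP => j; rewrite permvE !ffunE; congr (nat_of_bool _)%:Z.
apply/eqP/eqP => [e|->].
  have <- : cyc ord0 = j by rewrite -e permKV.
  by rewrite cycE; apply: val_inj; rewrite /= modn_small.
apply: (@perm_inj _ cyc); rewrite permKV cycE.
by apply: val_inj; rewrite /= modn_small.
Qed.

Lemma vl_tau p : vl (pact (tau m) p) = vl p - 1.
Proof.
case: p => a c; rewrite tauE /vl /pact /= !ffunE cycE /=.
have la := ltn_ord a.
have -> : (ord_pred a == ord_max) = (a == ord0).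
  by rewrite -(inj_eq (@ordS_inj _)) ord_predK -!val_eqE /= modnn.
case: (a =P ord0) => [->|a0] /=; first by rewrite modn_small //; lia.
have a0' : (a : nat) <> 0%N by move=> e; apply: a0; apply: val_inj.
have -> : (a + n).-1 = (a.-1 + n)%N by lia.
by rewrite modnDr modn_small; lia.
Qed.

Lemma s0E : s0 m = (ei ord_max - ei ord0, tperm ord0 ord_max).
Proof.
have Et : fword (word0 m) = tperm ord0 ord_max.
  rewrite /word0 fword_cat -/cyc.
  have -> : fword (behead (enum 'I_m.+1)) = (cyc^-1 * sfin ord0)%g.
    rewrite /cyc fword_rev invgK enum_ordSl /= fword_cons.
    by rewrite -mulgA sfinK mulg1.
  rewrite -[in LHS]mulgA -conjgE /sfin tpermJ !cycE tpermC.
  congr (tperm _ _); apply: val_inj; first by rewrite /= modnn.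
  by rewrite /= modn_small.
rewrite /s0 wprod_fW Et /wmul /fW /eX /= mul1g add0r; congr (_, _).
apply/ffunP => j; rewrite permvE !ffunE tpermV.
by case: tpermP => [->|->|/eqP/negPf-> /eqP/negPf->]; rewrite ?eqxx.
Qed.

Lemma ordS_eq (a i : 'I_n) :
  (ordS a == i) = if (i : nat) == 0%N then (a : nat) == m.+1 else a.+1 == i.
Proof.
rewrite -val_eqE /=; have la := ltn_ord a; have li := ltn_ord i.
have [e|ne] := eqVneq (a : nat) m.+1.
  by rewrite e modnn; case: (i : nat) li => [|b] //= lb; apply/esym/negbTE; lia.
rewrite modn_small; last by lia.
by case: (i : nat) => [|b] //=; rewrite (negbTE ne).
Qed.

(** One formula covers all simple reflections, [s0] included: index [i] exchanges the residue
    classes of [i - 1] and [i] modulo [n], the first moving up by one and the second down. *)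
Lemma vl_saff i p :
  vl (pact (saff i) p) = vl p + ((ordS p.1 == i) : nat)%:Z - ((p.1 == i) : nat)%:Z.
Proof.
case: p => a c; rewrite /= ordS_eq /saff; case: unliftP => [j ->|->].
  rewrite /vl /pact /= !ffunE sfinE /= -val_eqE /= /bump /= add1n eqSS.
  by case: eqP => [->|ne] /=; [rewrite eqn_leq ltnn andbF; lia|case: eqP; lia].
rewrite s0E /vl /pact /= -val_eqE /= !ffunE.
case: tpermP => [->|->|/eqP a0 /eqP am]; rewrite /= ?eqxx; try lia.
rewrite -!val_eqE /= in a0 am *.
by rewrite (negbTE a0) (negbTE am); lia.
Qed.

Lemma pact_tau1 p : (pact (tau m) p).1 = ord_pred p.1.
Proof. by rewrite tauE /pact /= cycE. Qed.

(** The rotation symmetry of the affine diagram. It carries facts about the finite reflections over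
    to [s0]. *)
Lemma tau_saff i : wmul (tau m) (saff i) = wmul (saff (ord_pred i)) (tau m).
Proof.
apply: vl_pact_inj => p; rewrite (pactM (tau m)) (pactM (saff _)).
rewrite vl_tau vl_saff (vl_saff (ord_pred i)) vl_tau pact_tau1.
rewrite ord_predK (inj_eq (@ord_pred_inj _)).
by rewrite -[p.1 == ord_pred i](inj_eq (@ordS_inj _)) ord_predK; lia.
Qed.

Lemma saffK i x : wmul (saff i) (wmul (saff i) x) = x.
Proof.
suff E : wmul (saff i) (saff i) = wone m by rewrite wmulA E wmul1w.
rewrite /saff; case: unliftP => [j _|_]; first by rewrite fWM sfinK.
rewrite s0E /wmul /= tperm2; congr (_, _); apply/ffunP => j.
rewrite !(permvE, ffunE) tpermV.
by case: tpermP => [->|->|/eqP/negPf-> /eqP/negPf->]; rewrite ?eqxx.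
Qed.

Lemma tau_powS j : wmul (tau m) (wpowz (tau m) j) = wpowz (tau m) (j + 1).
Proof.
case: j => [a|a]; first by rewrite -PoszD addn1.
rewrite NegzE; case: a => [|a]; first by rewrite /= wmulw1 wmulwV.
have -> : - a.+2%:Z + 1 = Negz a by lia.
by rewrite -NegzE /= wmulKVw.
Qed.

Lemma tau_powB j : wmul (winv (tau m)) (wpowz (tau m) j) = wpowz (tau m) (j - 1).
Proof. by rewrite -{1}[j](subrK 1) -tau_powS wmulKw. Qed.

Lemma vl_tau_pow j p : vl (pact (wpowz (tau m) j) p) = vl p - j.
Proof.
elim/int_rect: j p => [|a IH|a IH] p; first by rewrite /= pact1 subr0.
  by rewrite -[a.+1]addn1 PoszD -tau_powS pactM vl_tau IH; lia.
have -> : - a.+1%:Z = - a%:Z - 1 by lia.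
rewrite -tau_powB pactM; have := vl_tau (pact (winv (tau m)) (pact (wpowz (tau m) (- a%:Z)) p)).
by rewrite pactKV IH; lia.
Qed.

End AffinePermutations.

(** * Length and descents *)

(** Reversing a difference turns a floor [F >= 0] into [- F - 1], of absolute value [F + 1]. This is
    why a simple reflection changes [alen] by exactly one. *)
Lemma divNz_ndvd (N D : int) : 0 < N -> ~~ (N %| D)%Z ->
  ((- D) %/ N)%Z = - (D %/ N)%Z - 1.
Proof.
move=> N0 nd; have N0' : N != 0 by rewrite gt_eqF.
have r0 : (D %% N)%Z != 0 by apply: contra nd => /eqP/dvdz_mod0P.
have rge := modz_ge0 D N0'; have rlt := ltz_pmod D N0.
have {1}-> : - D = (- (D %/ N)%Z - 1) * N + (N - (D %% N)%Z).
  by rewrite {1}(divz_eq D N) mulrBl mulNr mul1r opprD -!addrA; congr (_ + _); lia.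
by rewrite divzMDl // (divz_small (m := _ - _)) ?addr0 //; apply/andP; split; lia.
Qed.

Section Length.
Variable m : nat.
Local Notation n := m.+2.
Local Notation lo i := (widen_ord (leqnSn m.+1) i).
Local Notation hi i := (lift ord0 i).
Implicit Types (w x y d : Wt m) (s t : {perm 'I_n}) (l : Zn m).

(** The inverse affine permutation on the window [0, ..., n - 1]; taking the inverse makes left
    multiplication by a finite permutation a mere permutation of the positions. *)
Definition iwin w (a : 'I_n) : int := vl (pact (winv w) (a, 0)).

Lemma iwinE w a : iwin w a = ((w.2^-1)%g a : nat)%:Z + n%:Z * w.1 a.
Proof. by rewrite /iwin /vl /pact /= !ffunE invgK permKV sub0r opprK. Qed.

Lemma iwin_inj w w' : iwin w =1 iwin w' -> w = w'.
Proof.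
move=> e; rewrite -[w]winvK -[w']winvK; congr winv.
by apply: pact_inj => a; apply: vl_inj; apply: e.
Qed.

Lemma iwin_ndvd w a b : a != b -> ~~ (n%:Z %| iwin w a - iwin w b)%Z.
Proof.
rewrite !iwinE => ab; apply/negP => /dvdzP[c e].
have [] : ((w.2^-1)%g a, w.1 a) = ((w.2^-1)%g b, w.1 b + c).
  by apply: vl_inj; rewrite /vl /= mulrDr [n%:Z * c]mulrC -e; lia.
by move=> /perm_inj eab _; rewrite eab eqxx in ab.
Qed.

Lemma iwin_eq w a b : (iwin w a == iwin w b) = (a == b).
Proof.
apply/eqP/eqP => [e|-> //]; apply/eqP; apply: contraT => /(iwin_ndvd w).
by rewrite e subrr dvdz0.
Qed.

Lemma iwin_fW s w a : iwin (wmul (fW s) w) a = iwin w ((s^-1)%g a).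
Proof. by rewrite !iwinE /= !ffunE add0r invMg permM. Qed.

Lemma iwin_sfin i w a : iwin (wmul (fW (sfin i)) w) a = iwin w (sfin i a).
Proof. by rewrite iwin_fW sfinV. Qed.

Lemma pact_winv_tau (a : 'I_n) :
  pact (winv (tau m)) (a, 0) = (ordS a, ((a == ord_max) : nat)%:Z).
Proof.
apply: vl_inj; apply: (@addIr _ (- 1)); rewrite -vl_tau pactKV /vl /=.
have la := ltn_ord a; rewrite -val_eqE /=.
case: eqP => [->|ne]; first by rewrite modnn; lia.
by rewrite modn_small; lia.
Qed.

Lemma iwin_tau w a :
  iwin (wmul (tau m) w) a = iwin w (ordS a) + n%:Z * ((a == ord_max) : nat)%:Z.
Proof. by rewrite /iwin winvM pactM pact_winv_tau vl_pact. Qed.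

(** Shi's formula for the length of an affine permutation; [ex_reduced] and [alen_aword] identify it
    with the word length. *)
Definition alen w : nat :=
  (\sum_(p : 'I_n * 'I_n | (p.1 < p.2)%N)
     `|((iwin w p.2 - iwin w p.1) %/ n%:Z)%Z|%N)%N.

(** [pact (tau m) (i, 0)] stands for the integer [i - 1], so this is an inversion of consecutive
    integers, that is, a left descent. For [i = 0] the integer [-1] lies outside the window, which
    accounts for [s0]. *)
Definition dsc w i : bool :=
  vl (pact (winv w) (i, 0)) < vl (pact (winv w) (pact (tau m) (i, 0))).

(** Rotation permutes the pairs of positions through [fp]. A pair that wraps around is reversed and
    shifted by [n]: the shift adds 1 to the floor, the reversal changes its sign and subtracts 1, so
    the absolute value is unchanged. *)
Lemma alen_tau w : alen (wmul (tau m) w) = alen w.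
Proof.
pose fp (p : 'I_n * 'I_n) :=
  if p.2 == ord_max then (ord0, ordS p.1) else (ordS p.1, ordS p.2).
pose fm (p : 'I_n * 'I_n) :=
  if p.1 == ord0 then (ord_pred p.2, ord_max) else (ord_pred p.1, ord_pred p.2).
have S0 (a : 'I_n) : (ordS a == ord0) = (a == ord_max).
  by rewrite ordS_eq -val_eqE.
have Smax : ordS (ord_max : 'I_n) = ord0 by apply/eqP; rewrite S0.
rewrite /alen [RHS](reindex_onto fp fm) /=; last first.
  move=> [c d] /= lcd; rewrite /fp /fm /=; case: (c =P ord0) => [->|/eqP c0] /=.
    by rewrite eqxx ord_predK.
  case: (ord_pred d =P ord_max) => [e|_]; last by rewrite !ord_predK.
  by move: lcd; rewrite -[d]ord_predK e Smax ltn0.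
apply: eq_big => [[c d]|[c d] /= lcd].
  rewrite /= /fp /fm /=; have lc := ltn_ord c; have ld := ltn_ord d.
  case: (d =P ord_max) => [->|/eqP dm] /=.
    rewrite ordSK xpair_eqE !eqxx !andbT /=.
    case: (c =P ord_max) => [->|/eqP cm] /=; first by rewrite modnn ltnn.
    have cm' : (c : nat) != m.+1 by rewrite -val_eqE in cm.
    by rewrite modn_small //=; lia.
  have dm' : (d : nat) != m.+1 by rewrite -val_eqE in dm.
  rewrite S0; case: (c =P ord_max) => [->|/eqP cm] /=.
    by rewrite xpair_eqE [ord_max == _]eq_sym (negbTE dm) andbF andbF; apply/negbTE; lia.
  have cm' : (c : nat) != m.+1 by rewrite -val_eqE in cm.
  by rewrite !ordSK eqxx andbT !modn_small //; lia.
rewrite !iwin_tau /fp /=.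
have cm : (c == ord_max) = false.
  by apply/negbTE; rewrite -val_eqE /=; have := ltn_ord d; lia.
rewrite cm mulr0 addr0; case: (d =P ord_max) => [->|_] /=; last by rewrite mulr0 addr0.
rewrite Smax mulr1.
have -> : iwin w ord0 + n%:Z - iwin w (ordS c) =
          1 * n%:Z + - (iwin w (ordS c) - iwin w ord0) by lia.
rewrite divzMDl // divNz_ndvd //; first by lia.
by apply: iwin_ndvd; rewrite S0 cm.
Qed.

Lemma alen_tau_pow j w : alen (wmul (wpowz (tau m) j) w) = alen w.
Proof.
elim/int_rect: j w => [|a IH|a IH] w; first by rewrite wmul1w.
  by rewrite -[a.+1]addn1 PoszD -tau_powS -wmulA alen_tau IH.
rewrite -(IH w); have -> : - a%:Z = - a.+1%:Z + 1 by lia.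
by rewrite -tau_powS -wmulA alen_tau.
Qed.

Lemma alen1 : alen (wone m) = 0%N.
Proof.
rewrite /alen big1 // => [[c d] /= lcd]; rewrite !iwinE /= !ffunE invg1 !perm1 !mulr0 !addr0.
by rewrite divz_small //; have := ltn_ord d; lia.
Qed.

Lemma ord_pred_max (i : 'I_n) : (ord_pred i == ord_max) = (i == ord0).
Proof.
rewrite -(inj_eq (@ordS_inj _)) ord_predK; congr (_ == _).
by apply: val_inj; rewrite /= modnn.
Qed.

Lemma dsc_tau w i : dsc (wmul (tau m) w) (ord_pred i) = dsc w i.
Proof.
set e := ((i == ord0) : nat)%:Z.
have E : (ord_pred i, 0) = pact (tau m) (i, e).
  by rewrite tauE /pact /= cycE !ffunE ord_pred_max subrr.
have E' : pact (tau m) (i, e) = ((pact (tau m) (i, 0)).1, (pact (tau m) (i, 0)).2 + e).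
  by rewrite /pact /=; congr (_, _); lia.
rewrite /dsc E winvM !(pactM (winv w)) !pactK E' vl_pact.
case: (pact (tau m) (i, 0)) => a c.
by rewrite /= (vl_pact _ a (c + e)) (vl_pact _ a c) mulrDr addrA ltrD2r.
Qed.

Lemma pact_tau_lift (i : 'I_m.+1) : pact (tau m) (hi i, 0) = (lo i, 0).
Proof.
apply: vl_inj; rewrite vl_tau /vl /= /bump /=; lia.
Qed.

Lemma dsc_fin w (i : 'I_m.+1) : dsc w (hi i) = (iwin w (hi i) < iwin w (lo i)).
Proof. by rewrite /dsc pact_tau_lift. Qed.

Lemma dsc0 w : dsc w ord0 = (iwin w ord0 < iwin w ord_max - n%:Z).
Proof.
rewrite /dsc; have -> : pact (tau m) (ord0, 0) = (ord_max, -1).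
  by apply: vl_inj; rewrite vl_tau /vl /=; lia.
by rewrite (vl_pact _ _ (-1)) mulrN1.
Qed.

Lemma alen_sfin w (i : 'I_m.+1) :
  iwin w (lo i) < iwin w (hi i) -> alen (wmul (fW (sfin i)) w) = (alen w).+1.
Proof.
move=> lt_iw; rewrite /alen (bigD1 (lo i, hi i)) /=; last by rewrite /bump /=; lia.
rewrite [in RHS](bigD1 (lo i, hi i)) /=; last by rewrite /bump /=; lia.
rewrite !iwin_sfin sfin_lo sfin_hi -[(_ + _).+1]addSn; congr (_ + _)%N.
  rewrite -opprB divNz_ndvd //; last by apply: iwin_ndvd; rewrite eq_sym lo_neq_hi.
  have : (0 <= (iwin w (hi i) - iwin w (lo i)) %/ n%:Z)%Z.
    by rewrite divz_ge0 // subr_ge0 ltW.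
  by move: (_ %/ _)%Z => D; lia.
have hK : involutive (fun p : 'I_n * 'I_n => (sfin i p.1, sfin i p.2)).
  by case=> c d; rewrite /= -!permM !sfinK !perm1.
rewrite [in RHS](reindex_inj (inv_inj hK)) /=; apply: eq_big => [[c d]|[c d] _] /=.
  rewrite !xpair_eqE -!val_eqE /= !sfinE /bump /= !add1n.
  by repeat case: ifP; lia.
by rewrite !iwin_sfin.
Qed.

Lemma saff_hi (i : 'I_m.+1) : saff (hi i) = fW (sfin i).
Proof. by rewrite /saff liftK. Qed.

(** For finite reflections this is [alen_sfin]; index 0 is the rotation of index 1, and [tau]
    preserves lengths. *)
Lemma alen_saff_up w i : ~~ dsc w i -> alen (wmul (saff i) w) = (alen w).+1.
Proof.
have fin j v : ~~ dsc v (hi j) -> alen (wmul (saff (hi j)) v) = (alen v).+1.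
  rewrite dsc_fin saff_hi -leNgt le_eqVlt iwin_eq.
  by rewrite (negbTE (lo_neq_hi j)) => /alen_sfin.
case: (unliftP ord0 i) => [j ->|->]; first exact: fin.
have E : ord0 = ord_pred (hi ord0) :> 'I_n by apply/(@ordS_inj _); rewrite ord_predK; apply: val_inj; rewrite /= modn_small.
rewrite {1}E -[w](wmulKVw (tau m)) dsc_tau => /fin H.
by rewrite E wmulA -tau_saff -wmulA !alen_tau.
Qed.

Lemma dsc_saff w i : dsc (wmul (saff i) w) i = ~~ dsc w i.
Proof.
have fin j v : dsc (wmul (saff (hi j)) v) (hi j) = ~~ dsc v (hi j).
  rewrite !dsc_fin saff_hi !iwin_sfin sfin_lo sfin_hi -leNgt [RHS]le_eqVlt iwin_eq.
  by rewrite (negbTE (lo_neq_hi j)).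
case: (unliftP ord0 i) => [j ->|->]; first exact: fin.
have E : ord0 = ord_pred (hi ord0) :> 'I_n by apply/(@ordS_inj _); rewrite ord_predK; apply: val_inj; rewrite /= modn_small.
by rewrite E -[w](wmulKVw (tau m)) dsc_tau wmulA -tau_saff -wmulA dsc_tau fin.
Qed.

Lemma alen_saff_down w i : dsc w i -> alen w = (alen (wmul (saff i) w)).+1.
Proof.
by move=> dw; rewrite -(@alen_saff_up _ i) ?saffK // dsc_saff dw.
Qed.

Lemma alen_saff_le w i : (alen (wmul (saff i) w) <= (alen w).+1)%N.
Proof.
case: (boolP (dsc w i)) => [/alen_saff_down->|/alen_saff_up->//].
by rewrite ltnW // ltnW.
Qed.

Lemma dscE w i : dsc w i = (alen (wmul (saff i) w) < alen w)%N.
Proof.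
case: (boolP (dsc w i)) => [/alen_saff_down->|/alen_saff_up->].
  by rewrite ltnSn.
by rewrite ltnNge leqnSn.
Qed.

Lemma iwin_tau_pow j a : iwin (wpowz (tau m) j) a = (a : nat)%:Z + j.
Proof.
rewrite /iwin; have := vl_tau_pow j (pact (winv (wpowz (tau m) j)) (a, 0)).
by rewrite pactKV {1}/vl /=; lia.
Qed.

(** The window of the inverse is increasing, and the condition at [s0] keeps its spread below [n].
    Being [n] distinct integers, its values are consecutive, so [w] is a shift. The bounds [up] and
    [dn] come from the two ends. *)
Lemma no_dsc w : (forall i, ~~ dsc w i) -> exists j, w = wpowz (tau m) j.
Proof.
move=> nd; exists (iwin w ord0); apply: iwin_inj => a; rewrite iwin_tau_pow.
have step (i : 'I_m.+1) : iwin w (lo i) + 1 <= iwin w (hi i).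
  have := nd (hi i); rewrite dsc_fin -leNgt le_eqVlt iwin_eq.
  by rewrite (negbTE (lo_neq_hi i)) => /=; lia.
have wrap : iwin w ord_max < iwin w ord0 + n%:Z.
  have := nd ord0; rewrite dsc0 -leNgt => h.
  have : ~~ (n%:Z %| iwin w ord_max - iwin w ord0)%Z by apply: iwin_ndvd.
  move=> nd0; rewrite lt_neqAle; apply/andP; split; last by lia.
  by apply: contra nd0 => /eqP->; rewrite addrAC subrr add0r dvdzz.
have up (k : nat) : (k <= m.+1)%N -> iwin w ord0 + k%:Z <= iwin w (inord k).
  elim: k => [|k IH] lk.
    by rewrite addr0 le_eqVlt iwin_eq -val_eqE /= inordK // eqxx.
  have := step (Ordinal lk); have := IH (ltnW lk).
  have -> : lo (Ordinal lk) = inord k by apply: val_inj; rewrite /= inordK // ltnW.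
  have -> : hi (Ordinal lk) = inord k.+1 by apply: val_inj; rewrite /= inordK.
  by lia.
have dn (k : nat) : (k <= m.+1)%N -> iwin w (inord (m.+1 - k)) <= iwin w ord0 + (m.+1 - k)%N%:Z.
  elim: k => [|k IH] lk.
    rewrite subn0; have -> : inord m.+1 = ord_max :> 'I_n by apply: val_inj; rewrite /= inordK.
    lia.
  have lk' : (m.+1 - k.+1 < m.+1)%N by lia.
  have := step (Ordinal lk'); have := IH (ltnW lk).
  have -> : lo (Ordinal lk') = inord (m.+1 - k.+1) by apply: val_inj; rewrite /= inordK // ltnW.
  have -> : hi (Ordinal lk') = inord (m.+1 - k).
    by apply: val_inj; rewrite /= inordK /bump /=; lia.
  by lia.
have la : (a <= m.+1)%N by rewrite -ltnS.
have := up a la; have := dn (m.+1 - a)%N (leq_subr _ _).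
by rewrite subKn // inord_val; lia.
Qed.

Lemma aword_cons i r j : aword (i :: r) j = wmul (saff i) (aword r j) :> Wt m.
Proof. by rewrite /aword /= wmulA. Qed.

Lemma alen_aword r j : (alen (aword r j : Wt m) <= size r)%N.
Proof.
elim: r => [|i r IH]; first by rewrite /aword /= wmul1w -[wpowz _ _]wmulw1 alen_tau_pow alen1.
by rewrite aword_cons (leq_trans (alen_saff_le _ _)).
Qed.

Lemma ex_reduced w : exists r j, aword r j = w /\ size r = alen w.
Proof.
move e : (alen w) => N; elim: N w e => [|N IH] w e.
  have [j ->] : exists j, w = wpowz (tau m) j.
    by apply: no_dsc => i; rewrite dscE e.
  by exists [::], j; rewrite /aword /= wmul1w.
case: (boolP [exists i, dsc w i]) => [/existsP[i di]|/existsPn nd]; last first.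
  by case: (no_dsc nd) e => j ->; rewrite -[wpowz _ _]wmulw1 alen_tau_pow alen1.
have := alen_saff_down di; rewrite e => -[/esym/IH[r [j [er sr]]]].
by exists (i :: r), j; rewrite aword_cons er saffK /= sr.
Qed.

Lemma areducedE w r j : areduced w r j <-> aword r j = w /\ size r = alen w.
Proof.
split=> [[e h]|[e h]]; split=> //.
  apply/eqP; rewrite eqn_leq -{2}e alen_aword andbT.
  by have [r' [j' [e' <-]]] := ex_reduced w; apply: h e'.
by move=> r' j' e'; rewrite h -e' alen_aword.
Qed.

Lemma alen_leE w w' : alen_le w w' <-> (alen w <= alen w')%N.
Proof.
split=> [h|h r' j' e].
  have [r' [j' [e' s']]] := ex_reduced w'.
  by have [r [j [<- le]]] := h _ _ e'; rewrite (leq_trans (alen_aword r j)) // -s'.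
have [r [j [e' s']]] := ex_reduced w; exists r, j; split=> //.
by rewrite s' (leq_trans h) // -e alen_aword.
Qed.

End Length.

(** * Parabolic subgroups and double cosets *)

Section Parabolic.
Variable m : nat.
Local Notation n := m.+2.
Local Notation lo i := (widen_ord (leqnSn m.+1) i).
Local Notation hi i := (lift ord0 i).
Implicit Types (w x y d : Wt m) (s t u b : {perm 'I_n}) (K J L : {set 'I_m.+1}).

Lemma alenM x y : (alen (wmul x y) <= alen x + alen y)%N.
Proof.
have [r [j [<- <-]]] := ex_reduced x; elim: r => [|i r IH].
  by rewrite /aword /= wmul1w alen_tau_pow.
by rewrite aword_cons -wmulA (leq_trans (alen_saff_le _ _)).
Qed.

Lemma winv_saff i : winv (saff i : Wt m) = saff i.
Proof. by apply: winv_uniq; rewrite -[X in wmul _ X]wmulw1 saffK. Qed.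

Lemma alen_saff i : (alen (saff i : Wt m) <= 1)%N.
Proof. by rewrite -[saff i]wmulw1 (leq_trans (alen_saff_le _ _)) ?alen1. Qed.

Lemma alenV w : alen (winv w) = alen w.
Proof.
have le x : (alen (winv x) <= alen x)%N.
  have [r [j [<- <-]]] := ex_reduced x; elim: r => [|i r IH].
    rewrite /aword /= wmul1w -(alen_tau_pow j) wmulwV; by rewrite alen1.
  rewrite aword_cons winvM winv_saff (leq_trans (alenM _ _)) //= -addn1.
  by rewrite leq_add // alen_saff.
by apply/eqP; rewrite eqn_leq le -{1}[w]winvK le.
Qed.

(** The description by integers of the shortest element of the coset [w W_K]; see [incr_alen] and
    [alen_incr_mul]. *)
Definition incr K w : bool :=
  [forall i in K, vl (pact w (lo i, 0)) < vl (pact w (hi i, 0))].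

Lemma incr_alen K w :
  (forall i, i \in K -> (alen w <= alen (wmul w (fW (sfin i))))%N) -> incr K w.
Proof.
move=> h; apply/forall_inP => i iK; rewrite ltNge; apply: contraL (h i iK).
rewrite -ltnNge le_eqVlt => /orP[/eqP/vl_inj/(can_inj (pactK w))|lt].
  by move=> /(congr1 fst)/esym/eqP; rewrite (negbTE (lo_neq_hi i)).
have: dsc (winv w) (hi i) by rewrite dsc_fin /iwin winvK.
by rewrite dscE saff_hi alenV -[wmul (fW _) _]winvK alenV winvM winvK winv_fW sfinV.
Qed.

Lemma aword_fin (r : seq 'I_m.+1) : aword [seq hi i | i <- r] 0 = fW (fword r).
Proof.
rewrite /aword /= wmulw1 -wprod_fW -map_comp; congr wprod.
by apply: eq_map => i; rewrite /= saff_hi.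
Qed.

Lemma dsc_fW0 s : dsc (fW s) ord0 = false.
Proof.
rewrite dsc0 !iwinE /= !ffunE !mulr0 !addr0; apply/negbTE.
by have := ltn_ord ((s^-1)%g ord_max); lia.
Qed.

Lemma no_dsc_fW s : (forall i : 'I_m.+1, ~~ dsc (fW s) (hi i)) -> s = 1%g.
Proof.
move=> nd; have [|j e] := @no_dsc _ (fW s).
  by move=> i; case: (unliftP ord0 i) => [k ->|->]; rewrite ?dsc_fW0.
suff j0 : j = 0 by move: e; rewrite j0 => -[].
have h a : ((s^-1)%g a : nat)%:Z = (a : nat)%:Z + j.
  by rewrite -iwin_tau_pow -e iwinE /= ffunE mulr0 addr0.
have := h ord0; have := h ord_max; have := ltn_ord ((s^-1)%g ord_max).
by rewrite /=; lia.
Qed.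

Lemma alen_fW0 s : alen (fW s) = 0%N -> s = 1%g.
Proof. by move=> e; apply: no_dsc_fW => i; rewrite dscE e. Qed.

Lemma ex_freduced s : exists r, fword r = s /\ size r = alen (fW s).
Proof.
move e : (alen _) => N; elim: N s e => [|N IH] s e.
  by exists [::]; rewrite (alen_fW0 e).
case: (boolP [exists i : 'I_m.+1, dsc (fW s) (hi i)]) => [/existsP[i di]|/existsPn nd].
  have := alen_saff_down di; rewrite e saff_hi fWM => -[/esym/IH[r [er sr]]].
  by exists (i :: r); rewrite fword_cons er -mulgA sfinK mulg1 /= sr.
by move: e; rewrite (no_dsc_fW nd) alen1.
Qed.

Lemma alen_fword (r : seq 'I_m.+1) : (alen (fW (fword r)) <= size r)%N.
Proof. by rewrite -aword_fin (leq_trans (alen_aword _ _)) ?size_map. Qed.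

Lemma freducedE s r : freduced s r <-> fword r = s /\ size r = alen (fW s).
Proof.
split=> [[e h]|[e h]]; split=> //.
  apply/eqP; rewrite eqn_leq -{2}e alen_fword andbT.
  by have [r' [e' <-]] := ex_freduced s; apply: h e'.
by move=> r' e'; rewrite h -e' alen_fword.
Qed.

Lemma flen_leE s t : flen_le s t <-> (alen (fW s) <= alen (fW t))%N.
Proof.
split=> [h|h r' e].
  have [r' [e' s']] := ex_freduced t.
  by have [r [<- le]] := h _ e'; rewrite (leq_trans (alen_fword r)) // -s'.
have [r [e' s']] := ex_freduced s; exists r; split=> //.
by rewrite s' (leq_trans h) // -e alen_fword.
Qed.

(* Two positions lie in the same [W_K]-orbit iff their [blk] values agree. *)
Definition blk K (a : 'I_n) : nat := #|[set i : 'I_m.+1 | (i < a)%N & i \notin K]|.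

Lemma blk_mono K (a b : 'I_n) : (a <= b)%N -> (blk K a <= blk K b)%N.
Proof.
move=> ab; apply: subset_leq_card; apply/subsetP => i.
by rewrite !inE => /andP[ia ->]; rewrite (leq_trans ia).
Qed.

Lemma blk_in K (a b : 'I_n) (i : 'I_m.+1) :
  blk K a = blk K b -> (a <= i < b)%N -> i \in K.
Proof.
move=> e /andP[ai ib]; apply: contraT => iK; suff: (blk K a < blk K b)%N by rewrite e ltnn.
apply: proper_card; apply/properP; split.
  apply/subsetP => j; rewrite !inE => /andP[ja ->].
  by rewrite (ltn_trans ja) // (leq_ltn_trans ai).
by exists i; rewrite !inE iK ?ib // andbT -leqNgt.
Qed.

Lemma blk_step K i : i \in K -> blk K (lo i) = blk K (hi i).
Proof.
move=> iK; congr #|pred_of_set _|; apply/setP => j; rewrite !inE /= /bump /= add1n ltnS.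
by case: ltngtP => //= /val_inj ->; rewrite iK.
Qed.

Lemma blk_WK K u a : u \in WK K -> blk K (u a) = blk K a.
Proof.
pose G0 := [set t : {perm 'I_n} | [forall a, blk K (t a) == blk K a]].
have gG0 : group_set G0.
  apply/group_setP; split=> [|s t]; first by rewrite inE; apply/forallP => c; rewrite perm1.
  rewrite !inE => /forallP hs /forallP ht; apply/forallP => c.
  by rewrite permM (eqP (ht _)) (eqP (hs _)).
have sub : WK K \subset G0.
  rewrite -[G0]/(gval (Group gG0)) gen_subG; apply/subsetP => _ /imsetP[i iK ->].
  rewrite inE; apply/forallP => c; rewrite /sfin; case: tpermP => [->|->|//].
    by rewrite blk_step.
  by rewrite blk_step.
by move=> /(subsetP sub); rewrite inE => /forallP/(_ a)/eqP.
Qed.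

Lemma sfin_WK K i : i \in K -> sfin i \in WK K.
Proof. by move=> iK; apply: mem_gen; apply: imset_f. Qed.

Lemma incr_blk K w (a b : 'I_n) c : incr K w -> (a < b)%N -> blk K a = blk K b ->
  vl (pact w (a, c)) < vl (pact w (b, c)).
Proof.
move=> /forall_inP iw; rewrite (vl_pact _ a) (vl_pact _ b) ltrD2r.
move e : (b - a)%N => N; elim: N b e => [|N IH] b e ab; first by lia.
case: (unliftP ord0 b) e ab => [j ->|->]; last by rewrite ltn0.
rewrite /= /bump /= => e ab eb.
have jK : j \in K by apply: blk_in eb _; rewrite /= /bump /=; lia.
have [eaj|naj] := eqVneq (a : nat) j.
  have -> : a = lo j by apply: val_inj.
  exact: iw.
apply: lt_trans (iw _ jK); apply: IH; last by rewrite blk_step.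
  by rewrite /=; lia.
by rewrite ltn_neqAle naj -ltnS.
Qed.

(** Blocks are intervals of positions and [W_K] preserves each of them, so it can reverse two
    integers only within one block. *)
Lemma WK_order K u (P Q : 'I_n * int) : u \in WK K -> vl P < vl Q ->
  (P.2 == Q.2) && (blk K P.1 == blk K Q.1) = false ->
  vl (pact (fW u) P) < vl (pact (fW u) Q).
Proof.
case: P Q => [a c] [b e] uK; rewrite /vl /pact /= !ffunE !subr0.
have la := ltn_ord a; have lb := ltn_ord b.
have lua := ltn_ord (u a); have lub := ltn_ord (u b).
have [ -> lt /= /negbT nb|ce lt _] := eqVneq c e; last by nia.
have ab : (a < b)%N by lia.
have : (blk K (u a) < blk K (u b))%N.
  by rewrite !blk_WK // ltn_neqAle nb blk_mono // ltnW.
rewrite ltnNge => /negP nle; suff : (u a < u b)%N by lia.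
by rewrite ltnNge; apply/negP => /(@blk_mono K).
Qed.

(** Induction on the length of [x], stripping a left descent [i]. It stays a descent of [x b]: the
    preimages of [i] and [i - 1] could be reversed by [W_J] only inside one block, where [x] is
    increasing. *)
Lemma alen_incr_mul J x b : incr J x -> b \in WK J ->
  alen (wmul x (fW b)) = (alen x + alen (fW b))%N.
Proof.
move=> ix bJ; move e : (alen x) => N; elim: N x ix e => [|N IH] x ix e.
  have [j ->] : exists j, x = wpowz (tau m) j by apply: no_dsc => i; rewrite dscE e.
  by rewrite alen_tau_pow.
have [i di] : exists i, dsc x i.
  apply/existsP; apply: contraT => /existsPn/no_dsc[j ej].
  by move: e; rewrite ej -[wpowz _ _]wmulw1 alen_tau_pow alen1.
have ex' := alen_saff_down di.
have dxb : dsc (wmul x (fW b)) i.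
  rewrite /dsc winvM winv_fW !(pactM (fW _)).
  set P := pact (winv x) (i, 0); set Q := pact (winv x) _.
  have ltPQ : vl P < vl Q by [].
  apply: (@WK_order J); rewrite ?groupV //; apply/negbTE/negP => /andP[/eqP e2 /eqP eb].
  have : vl (pact x P) < vl (pact x Q).
    rewrite [P]surjective_pairing [Q]surjective_pairing e2.
    apply: incr_blk => //; move: ltPQ; rewrite /vl e2; lia.
  by rewrite !pactKV vl_tau; lia.
(* [saff i] reverses only consecutive integers [i - 1], [i] modulo [n]. If [x] sent two neighbouring
   positions to such a pair in increasing order, [i] would not be a descent of [x]. *)
have ix' : incr J (wmul (saff i) x).
  apply/forall_inP => j jJ; have := forall_inP ix j jJ; rewrite !pactM.
  set P := pact x (lo j, 0); set Q := pact x (hi j, 0) => ltPQ.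
  have nPQ : vl (pact (saff i) P) != vl (pact (saff i) Q).
    apply/eqP => /vl_inj/(can_inj (pactK _)) ePQ; by rewrite ePQ ltxx in ltPQ.
  rewrite lt_neqAle nPQ /= !vl_saff.
  have [e1|ne1] := eqVneq (vl Q) (vl P + 1); last first.
    case: (ordS P.1 == i); case: (P.1 == i); case: (ordS Q.1 == i); case: (Q.1 == i) => /=; lia.
  have ePQ : P = pact (tau m) Q by apply: vl_inj; rewrite vl_tau e1; lia.
  have -> : ordS P.1 = Q.1 by rewrite ePQ pact_tau1 ord_predK.
  case: (Q.1 =P i) => [eQi|_]; last by case: (P.1 == i); case: (ordS Q.1 == i) => /=; lia.
  have Qe : Q = (i, Q.2) by rewrite -eQi -surjective_pairing.
  have : vl (pact (winv x) Q) < vl (pact (winv x) P).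
    rewrite ePQ Qe vl_pact.
    have -> : pact (tau m) (i, Q.2) = ((pact (tau m) (i, 0)).1, (pact (tau m) (i, 0)).2 + Q.2).
      by rewrite /pact /=; congr (_, _); lia.
    move: di; rewrite /dsc; case: (pact (tau m) (i, 0)) => a c /=.
    by rewrite (vl_pact _ a (c + _)) (vl_pact _ a c); lia.
  by rewrite !pactK /vl /= /bump /=; lia.
have := IH _ ix'; rewrite -wmulA => IH'.
by rewrite (alen_saff_down dxb) IH' //; move: ex'; rewrite e => -[].
Qed.

Lemma alen_mul_incr K d u : incr K (winv d) -> u \in WK K ->
  alen (wmul (fW u) d) = (alen (fW u) + alen d)%N.
Proof.
move=> id uK; rewrite -alenV winvM winv_fW (alen_incr_mul id) ?groupV //.
by rewrite alenV -winv_fW alenV addnC.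
Qed.

(** Both elements are shortest in the same coset, and additivity used in both directions leaves
    length 0 for [b]. *)
Lemma incr_uniq J x b : incr J x -> incr J (wmul x (fW b)) -> b \in WK J -> b = 1%g.
Proof.
move=> ix ixb bJ; apply: alen_fW0.
have := alen_incr_mul ixb (groupVr bJ); rewrite -winv_fW wmulwK alenV.
by rewrite (alen_incr_mul ix bJ); lia.
Qed.

Lemma ex_incr J x : exists2 b, b \in WK J & incr J (wmul x (fW b)).
Proof.
case: (@arg_minnP {perm 'I_n} 1%g (fun b => b \in WK J) (fun b => alen (wmul x (fW b)))).
  exact: group1.
move=> b bJ bmin; exists b => //; apply: incr_alen => i iJ.
by rewrite -wmulA fWM; apply: bmin; rewrite groupM // sfin_WK.
Qed.

Lemma DminE K L s : L \subset K ->
  Dmin K L s <-> (s \in WK K) && incr L (fW s).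
Proof.
move=> LK; split=> [[sK h]|/andP[sK iLs]].
  rewrite sK; apply: incr_alen => i iL; rewrite fWM.
  by apply/flen_leE; apply: h; apply: sfin_WK.
by split=> // v vL; apply/flen_leE; rewrite -fWM (alen_incr_mul iLs vL) leq_addr.
Qed.

Lemma Dcos_incr K J d : Dcos K J d -> incr J d /\ incr K (winv d).
Proof.
move=> h; split; apply: incr_alen => i iK.
  have /alen_leE := h 1%g (sfin i) (group1 _) (sfin_WK iK).
  by rewrite wmul1w.
have /alen_leE := h (sfin i) 1%g (sfin_WK iK) (group1 _).
by rewrite wmulw1 alenV -[wmul (winv d) _]winvK alenV winvM winvK winv_fW sfinV.
Qed.

(** * Unique factorisation in a double coset *)

Section DoubleCoset.
Variables (K J : {set 'I_m.+1}) (d : Wt m).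
Hypotheses (idJ : incr J d) (idK : incr K (winv d)).
Local Notation L := (KdJ K J d).

Lemma KdJ_sub : L \subset K.
Proof. by apply/subsetP => i; rewrite inE => /andP[]. Qed.

(* If [a] reverses [d(j) < d(j+1)], both lie in one [K]-block, on which      *)
(* [d^-1] is increasing; so they are consecutive and [d s_j d^-1] is simple. *)
Lemma incr_mul_d a : a \in WK K -> incr L (fW a) -> incr J (wmul (fW a) d).
Proof.
move=> aK /forall_inP iaL; apply/forall_inP => j jJ; rewrite !pactM.
have := forall_inP idJ j jJ; set P := pact d (lo j, 0); set Q := pact d (hi j, 0) => ltPQ.
have [defP defQ] : P = pact d (lo j, 0) /\ Q = pact d (hi j, 0) by [].
clearbody P Q; case E : ((P.2 == Q.2) && (blk K P.1 == blk K Q.1)); last exact: WK_order ltPQ E.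
case/andP: E => /eqP e2 /eqP eb.
have eP : P = (P.1, P.2) by apply: surjective_pairing.
have eQ : Q = (Q.1, P.2) by rewrite e2 -surjective_pairing.
have lt1 : (P.1 < Q.1)%N by move: ltPQ; rewrite /vl e2; lia.
have lp : (P.1 < m.+1)%N by have := ltn_ord Q.1; lia.
pose i := Ordinal lp.
have ePi : P.1 = lo i by apply: val_inj.
have eQi : Q.1 = hi i.
  apply: val_inj; rewrite /= /bump /=.
  case: (ltngtP Q.1 P.1.+1) => [||->]; [lia| |lia] => lt2; exfalso.
  have b1 : blk K (hi i) = blk K Q.1.
    apply/eqP; rewrite eqn_leq blk_mono /=; last by rewrite /bump /=; lia.
    by rewrite -eb blk_mono //= /bump /=; lia.
  have l1 : vl (pact (winv d) (P.1, P.2)) < vl (pact (winv d) (hi i, P.2)).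
    by apply: incr_blk idK _ _; rewrite ?b1 //= /bump /=; lia.
  have l2 : vl (pact (winv d) (hi i, P.2)) < vl (pact (winv d) (Q.1, P.2)).
    by apply: incr_blk idK _ _; rewrite ?b1 //= /bump /=; lia.
  by move: l1 l2; rewrite -eP -eQ defP defQ !pactK /vl /= /bump /=; lia.
have iK : i \in K by apply: blk_in eb _; rewrite eQi /= /bump /=; lia.
have iL : i \in L.
  rewrite inE iK /=; apply/exists_inP; exists j => //; apply/eqP.
  have s1 : d.2 (lo j) = lo i by rewrite -ePi defP.
  have s2 : d.2 (hi j) = hi i by rewrite -eQi defQ.
  have c1 : d.1 (lo i) = - P.2 by rewrite -ePi defP /= sub0r opprK.
  have c2 : d.1 (hi i) = - P.2 by rewrite -eQi e2 defQ /= sub0r opprK.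
  rewrite /wmul /winv /fW /=; congr (_, _).
    rewrite add0r -permvN -permvD.
    suff -> : permv (sfin i) d.1 = d.1 by rewrite addNr permv0.
    apply/ffunP => c; rewrite permvE sfinV /sfin.
    by case: tpermP => [->|->|//]; rewrite c1 c2.
  rewrite -mulgA -{1}[d.2]invgK -conjgE /sfin tpermJ.
  by congr (tperm _ _); rewrite -?s1 -?s2 permK.
rewrite eP eQ (vl_pact _ _ P.2) (vl_pact _ Q.1 P.2) ltrD2r ePi eQi.
exact: iaL.
Qed.

Lemma WL_d c : c \in WK L -> exists2 c', c' \in WK J & wmul (fW c) d = wmul d (fW c').
Proof.
pose G0 := [set t : {perm 'I_n} | [exists c' in WK J, wmul (fW t) d == wmul d (fW c')]].
have gG0 : group_set G0.
  apply/group_setP; split=> [|s t].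
    by rewrite inE; apply/exists_inP; exists 1%g; rewrite ?group1 // wmul1w wmulw1.
  rewrite !inE => /exists_inP[s' s'J /eqP es] /exists_inP[t' t'J /eqP et].
  apply/exists_inP; exists (s' * t')%g; rewrite ?groupM //.
  by rewrite -!fWM -wmulA es wmulA et wmulA.
have sub : WK L \subset G0.
  rewrite -[G0]/(gval (Group gG0)) gen_subG; apply/subsetP => _ /imsetP[i iL ->].
  move: iL; rewrite !inE => /andP[_ /exists_inP[j jJ /eqP e]].
  by apply/exists_inP; exists (sfin j); rewrite ?sfin_WK // -e wmulKVw.
by move=> /(subsetP sub); rewrite inE => /exists_inP[c' ? /eqP ?]; exists c'.
Qed.

(** Existence: a factor of [a] in [W_L] is split off and moved across [d] into [W_J] by [WL_d].
    Uniqueness: [a d] is shortest in its coset modulo [W_J] by [incr_mul_d], so [incr_uniq]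
    determines [b]. *)
Lemma dcoset_perm :
  perm_eq (dcoset K J d)
    [seq wmul (wmul (fW a) d) (fW b) | a <- enum [set a in WK K | incr L (fW a)],
                                       b <- enum (WK J)].
Proof.
apply: uniq_perm; first exact: undup_uniq.
  apply: allpairs_uniq; rewrite ?enum_uniq // => -[a b] [a' b'].
  move=> /allpairsP[[a1 b1] [/= a1K b1J [-> ->]]] /allpairsP[[a2 b2] [/= a2K b2J [-> ->]]] /= e.
  move: a1K b1J a2K b2J; rewrite !mem_enum !inE => /andP[a1K i1] b1J /andP[a2K i2] b2J.
  have e' : wmul (fW a2) d = wmul (wmul (fW a1) d) (fW (b2^-1 * b1)%g).
    by rewrite -fWM wmulA e -winv_fW wmulwK.
  have b12 : (b2^-1 * b1)%g = 1%g.
    apply: (@incr_uniq J (wmul (fW a1) d)); rewrite -?e' ?incr_mul_d //.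
    by rewrite groupM ?groupV.
  move: e'; rewrite b12 wmulw1 => /wmulwI[->]; congr (_, _).
  by apply: (mulgI (b2^-1)%g); rewrite b12 mulVg.
move=> v; rewrite mem_undup; apply/allpairsP/allpairsP => -[[a b] /= [aK bJ ->]].
  move: aK bJ; rewrite !mem_enum => aK bJ.
  have [c cL ic] := ex_incr L (fW a); rewrite fWM in ic.
  have [c' c'J ec] := WL_d (groupVr cL).
  exists ((c * a)%g, (b * c')%g); split; rewrite /= ?mem_enum ?inE ?groupM //=.
    by apply: subsetP (genS _) _ cL; apply: imsetS; apply: KdJ_sub.
  rewrite -!fWM -!wmulA; congr wmul.
  by rewrite (wmulA d (fW c')) -ec -winv_fW -wmulA wmulKVw.
move: aK bJ; rewrite !mem_enum inE => /andP[aK _] bJ.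
by exists (a, b); rewrite /= !mem_enum.
Qed.

End DoubleCoset.
End Parabolic.

(** * The ring of Laurent polynomials *)

Section MmapMul.
Variables (m : nat) (k : fieldType) (S : nzRingType).
Variables (phi : {rmorphism k -> S}) (h : Zn m -> S).
Hypotheses (hD : forall l l', h (l + l') = h l * h l')
  (hC : forall c l, GRing.comm (phi c) (h l)).

Lemma mmap_Lmul (f g : Laur m k) : mmap phi h (Lmul f g) = mmap phi h f * mmap phi h g.
Proof.
rewrite /Lmul raddf_sum /= [in RHS]/mmap mulr_suml; apply: eq_bigr => l _.
rewrite raddf_sum /= mulr_sumr; apply: eq_bigr => l' _.
rewrite mmapU /= rmorphM hD -!mulrA; congr (_ * _).
by rewrite !mulrA; congr (_ * _); apply: hC.
Qed.

End MmapMul.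

(* The ring axioms and the absence of zero divisors are pulled back along an  *)
(* embedding into the fraction field of the polynomial ring.                  *)
Section Embedding.
Import mpoly.
Variables (m : nat) (k : fieldType).
Local Notation n := m.+2.
Local Notation PP := (mpoly.mpoly n k).
Local Notation FF := {fraction PP}.

Definition frX (i : 'I_n) : FF := FracField.tofrac (mpoly.mpolyX k (mpoly.mnm1 i)).
Definition frmon (l : Zn m) : FF := \prod_(i < n) frX i ^ l i.
Definition frC (c : k) : FF := FracField.tofrac (mpoly.mpolyC n c).

Fact frC_zmod : zmod_morphism frC.
Proof. by move=> a b; rewrite /frC !rmorphB. Qed.
Fact frC_monoid : monoid_morphism frC.
Proof. by split=> [|a b]; rewrite /frC ?rmorph1 ?rmorphM. Qed.
HB.instance Definition _ := GRing.isZmodMorphism.Build k FF frC frC_zmod.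
HB.instance Definition _ := GRing.isMonoidMorphism.Build k FF frC frC_monoid.

Lemma frX_neq0 i : frX i != 0.
Proof.
rewrite tofrac_eq0; apply/eqP => /(congr1 (mpoly.mcoeff (mpoly.mnm1 i))).
by rewrite mpoly.mcoeffX eqxx mpoly.mcoeff0 => /eqP; rewrite oner_eq0.
Qed.

Lemma frmonD l l' : frmon (l + l') = frmon l * frmon l'.
Proof.
rewrite /frmon -big_split; apply: eq_bigr => i _ /=.
by rewrite ffunE expfzDr // frX_neq0.
Qed.

Definition frE : Laur m k -> FF := monalg.mmap frC frmon.

Lemma frE_mul f g : frE (Lmul f g) = frE f * frE g.
Proof. by apply: mmap_Lmul => [|c l]; [exact: frmonD|apply: mulrC]. Qed.

Lemma frmon_nat (l : Zn m) : (forall i, 0 <= l i) ->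
  frmon l = FracField.tofrac (mpoly.mpolyX k (mpoly.Multinom [tuple `|l i|%N | i < n])).
Proof.
move=> l0; rewrite mpoly.mpolyXE_id rmorph_prod /=; apply: eq_bigr => i _.
by rewrite rmorphXn /= mpoly.mnmE -{1}(gez0_abs (l0 i)).
Qed.

(** Multiplication by the monomial with all exponents [B], a bound for the exponents in the support,
    turns the Laurent polynomial into a polynomial with the same coefficients, which can then be
    read off. *)
Lemma frE_inj : injective frE.
Proof.
move=> f g /eqP; rewrite -subr_eq0 -raddfB /= => /eqP e; apply/eqP; rewrite -subr_eq0.
move: (f - g) e => {f g} f e; apply/eqP/malgP => l0; rewrite monalg.mcoeff0.
have [l0f|/monalg.mcoeff_outdom//] := boolP (l0 \in monalg.msupp f).
pose B := (\sum_(l <- monalg.msupp f) \sum_(i < n) `|l i|%N)%N.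
pose sh : Zn m := [ffun=> B%:Z].
have pos l : l \in monalg.msupp f -> forall i, 0 <= (l + sh) i.
  move=> lf i; have -> : (l + sh) i = l i + B%:Z :> int by rewrite !ffunE.
  have : (`|l i|%N <= B)%N.
    rewrite /B (big_fsetD1 l) //= (bigD1 i) //= -addnA leq_addr //.
  by lia.
pose mu (l : Zn m) := mpoly.Multinom [tuple absz ((l + sh) i) | i < n].
have E : FracField.tofrac (\sum_(l <- monalg.msupp f) monalg.mcoeff l f *: mpoly.mpolyX k (mu l)) = 0.
  rewrite -[RHS](mul0r (frmon sh)) -e /frE /monalg.mmap mulr_suml raddf_sum /= big_seq [RHS]big_seq.
  apply: eq_bigr => l lf; rewrite -mulrA -frmonD frmon_nat; last exact: pos.
  by rewrite -mpoly.mul_mpolyC rmorphM.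
move: E => /eqP; rewrite tofrac_eq0 => /eqP/(congr1 (mpoly.mcoeff (mu l0))).
rewrite mpoly.mcoeff0 raddf_sum /= (big_fsetD1 l0) //= mpoly.mcoeffZ mpoly.mcoeffX eqxx mulr1.
rewrite big_seq big1 ?addr0 // => l; rewrite in_fsetD1 => /andP[nl lf].
rewrite mpoly.mcoeffZ mpoly.mcoeffX; case: eqP => [/mpoly.mnmP emu|]; last by rewrite mulr0.
case/eqP: nl; apply/ffunP => i; have := emu i; rewrite !mpoly.mnmE.
have e1 (l' : Zn m) : (l' + sh) i = l' i + B%:Z :> int by rewrite !ffunE.
have aux (a b c : int) : 0 <= a + c -> 0 <= b + c -> absz (a + c) = absz (b + c) -> b = a.
  by lia.
by rewrite !e1 => /esym; apply: aux; rewrite -e1; apply: pos.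
Qed.

End Embedding.

Section LaurentRing.
Variables (m : nat) (k : fieldType).
Local Notation n := m.+2.
Local Notation L := (Laur m k).

HB.instance Definition _ := GRing.Lmodule.on L.

Definition Lone : L := << 1 *g 0 >>.

Lemma frE1 : frE Lone = 1.
Proof.
rewrite /frE mmapU /= rmorph1 mul1r /frmon big1 // => i _.
by rewrite ffunE expr0z.
Qed.

Fact LmulA : associative (@Lmul m k).
Proof. by move=> f g h; apply: frE_inj; rewrite !frE_mul mulrA. Qed.
Fact LmulC : commutative (@Lmul m k).
Proof. by move=> f g; apply: frE_inj; rewrite !frE_mul mulrC. Qed.
Fact Lmul1f : left_id Lone (@Lmul m k).
Proof. by move=> f; apply: frE_inj; rewrite !frE_mul frE1 mul1r. Qed.
Fact LmulDl : left_distributive (@Lmul m k) +%R.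
Proof.
move=> f g h; apply: frE_inj; rewrite frE_mul /frE !raddfD /= -!/(frE _).
by rewrite !frE_mul mulrDl.
Qed.
Fact Lone_neq0 : Lone != 0.
Proof. by rewrite monalgU_eq0 oner_eq0. Qed.

HB.instance Definition _ := GRing.Zmodule_isComNzRing.Build L
  LmulA LmulC Lmul1f LmulDl Lone_neq0.

Lemma LmulE (f g : L) : Lmul f g = f * g. Proof. by []. Qed.

Lemma frEZ c (f : L) : frE (c *: f) = frC m c * frE f.
Proof.
rewrite /frE (mmapEw (msuppZ_le c f)) /mmap mulr_sumr; apply: eq_bigr => l _.
by rewrite mcoeffZ /= rmorphM mulrA.
Qed.

Fact LscaleAl (c : k) (f g : L) : c *: (f * g) = c *: f * g.
Proof. by apply: frE_inj; rewrite frEZ !frE_mul frEZ mulrA. Qed.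

HB.instance Definition _ := GRing.Lmodule_isLalgebra.Build k L LscaleAl.
HB.instance Definition _ := GRing.Lalgebra_isComAlgebra.Build k L.

Lemma Lmul_eq0 (f g : L) : (f * g == 0) = (f == 0) || (g == 0).
Proof.
have E0 (h : L) : (h == 0) = (frE h == 0).
  by rewrite -(inj_eq (@frE_inj m k)) [frE 0]raddf0.
by rewrite !E0 frE_mul mulf_eq0.
Qed.

Lemma LmulI (f g h : L) : f != 0 -> f * g = f * h -> g = h.
Proof.
move=> f0 /eqP; rewrite -subr_eq0 -mulrBr Lmul_eq0 (negbTE f0) /= subr_eq0.
by move/eqP.
Qed.

Lemma Lprod_neq0 (I : Type) (r : seq I) (P : pred I) (F : I -> L) :
  (forall i, P i -> F i != 0) -> \prod_(i <- r | P i) F i != 0.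
Proof.
move=> h; elim/big_ind: _ => [|f g f0 g0|i Pi]; rewrite ?oner_eq0 ?h //.
by rewrite Lmul_eq0 negb_or f0.
Qed.

Lemma LmonM (c c' : k) (l l' : Zn m) :
  (<< c *g l >> : L) * << c' *g l' >> = << c * c' *g l + l' >>.
Proof.
by apply: frE_inj; rewrite frE_mul /frE !mmapU /= rmorphM frmonD mulrACA.
Qed.

Lemma LmonZ (c : k) (l : Zn m) : (<< c *g l >> : L) = c *: << 1 *g l >>.
Proof. by apply/malgP => l'; rewrite mcoeffZ !mcoeffU mulr_natr. Qed.

Lemma permL_mmap s (f : L) : permL s f = mmap (in_alg L) (fun l => << 1 *g permv s l >> : L) f.
Proof.
rewrite /permL /mmap; apply: eq_bigr => l _.
by rewrite LmonZ /= mulr_algl.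
Qed.

Lemma permLU s c (l : Zn m) : permL s (<< c *g l >> : L) = << c *g permv s l >>.
Proof. by rewrite permL_mmap mmapU /= mulr_algl -LmonZ. Qed.

Fact permL_zmod s : zmod_morphism (permL s : L -> L).
Proof. by move=> f g; rewrite !permL_mmap [LHS]raddfB. Qed.

Fact permL_monoid s : monoid_morphism (permL s : L -> L).
Proof.
split=> [|f g]; first by rewrite permLU permv0.
rewrite !permL_mmap -LmulE; apply: mmap_Lmul => [l l'|c l]; last exact: mulrC.
by rewrite LmonM mulr1 permvD.
Qed.

HB.instance Definition _ s := GRing.isZmodMorphism.Build L L (permL s) (permL_zmod s).
HB.instance Definition _ s := GRing.isMonoidMorphism.Build L L (permL s) (permL_monoid s).

Lemma permLZ s c (f : L) : permL s (c *: f) = c *: permL s f.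
Proof.
rewrite -[c *: f]mulr_algl rmorphM /= -[RHS]mulr_algl; congr (_ * _).
by rewrite -LmonZ permLU permv0.
Qed.

Lemma Laur_ind (P : L -> Prop) :
  P 0 -> (forall f g, P f -> P g -> P (f + g)) -> (forall c l, P << c *g l >>) ->
  forall f, P f.
Proof. by move=> P0 PD PU f; rewrite [f]monalgE; elim/big_ind: _ => //. Qed.

Lemma permLM s t (f : L) : permL (s * t)%g f = permL t (permL s f).
Proof.
elim/Laur_ind: f => [|f g Hf Hg|c l]; first by rewrite !raddf0.
  by rewrite !raddfD /= Hf Hg.
by rewrite !permLU permvM.
Qed.

Lemma permL1 (f : L) : permL 1%g f = f.
Proof.
elim/Laur_ind: f => [|f g Hf Hg|c l]; first by rewrite raddf0.
  by rewrite raddfD /= Hf Hg.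
by rewrite permLU permv1.
Qed.

Lemma permL_eq0 s (f : L) : (permL s f == 0) = (f == 0).
Proof.
apply/eqP/eqP => [e|->]; last exact: raddf0.
by rewrite -[f]permL1 -(mulgV s) permLM e raddf0.
Qed.

(* Evaluating at [X^l], ..., [X^(N l)] with [l] regular reduces the           *)
(* independence of the [permL s] to polynomial interpolation.                 *)
Lemma permL_indep (c : {perm 'I_n} -> L) :
  (forall f, \sum_s c s * permL s f = 0) -> forall s, c s = 0.
Proof.
move=> h s; pose l0 : Zn m := [ffun i : 'I_n => (i : nat)%:Z].
pose y t : L := permL t << 1 *g l0 >>.
have y_inj : injective y.
  move=> t t'; rewrite /y !permLU => /malgP/(_ (permv t l0)).
  rewrite !mcoeffUU mcoeffU; case: eqP => [e _|_ /eqP]; last by rewrite mulr0n oner_eq0.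
  apply/invg_inj/permP => j; apply: val_inj.
  by have := congr1 (fun g : Zn m => g j) e; rewrite !permvE !ffunE => -[].
pose P : {poly L} := \prod_(t | t != s) ('X - (y t)%:P).
have hP : \sum_t c t * P.[y t] = 0.
  under eq_bigr => t _ do rewrite horner_coef mulr_sumr.
  rewrite exchange_big big1 //= => i _.
  under eq_bigr => t _ do rewrite mulrCA.
  rewrite -mulr_sumr; under eq_bigr => t _ do rewrite -rmorphXn.
  by rewrite h mulr0.
move: hP; rewrite (bigD1 s) //= big1 ?addr0.
  move/eqP; rewrite Lmul_eq0 => /orP[/eqP//|]; rewrite horner_prod => /negPn/negP[].
  apply: Lprod_neq0 => t ts; rewrite hornerXsubC subr_eq0.
  by apply: contra ts => /eqP/y_inj->.
move=> t ts; suff -> : P.[y t] = 0 by rewrite mulr0.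
by rewrite /P (bigD1 t) //= hornerM hornerXsubC subrr mul0r.
Qed.

End LaurentRing.

(** * Reduced words in the affine Hecke algebra *)

(* With [c * x] for [T_tau]: conjugation by its square takes [t] to [z]. *)
Lemma rot_square (R : nzRingType) (c c' d t x y z : R) :
  c = c' * t -> c' * x = x * c' -> t * x * t = y -> x * y = y * x ->
  c * c' = d * c -> z * d = c -> c * x * (c * x) * t = z * (c * x) * (c * x).
Proof.
move=> ec cx ety xy cd zd.
have -> : c * x * (c * x) * t = c * (c' * (x * y)).
  by rewrite {2}ec -!mulrA (mulrA t) ety (mulrA x) -cx -!mulrA.
have -> : z * (c * x) * (c * x) = c * (c * (x * (t * x))).
  rewrite {2}ec -!mulrA (mulrA x c') -cx -(mulrA c') (mulrA c c') cd -mulrA.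
  by rewrite (mulrA z d) zd.
by rewrite {3}ec -(mulrA c') (mulrA x) (mulrA t (x * t)) (mulrA t x) ety xy.
Qed.

Section HeckeRelations.
Variables (m : nat) (k : fieldType) (q : nat) (sq : k) (H : algType k).
Variables (T : 'I_m.+1 -> H) (X Xi : 'I_m.+2 -> H).
Local Notation n := m.+2.
Local Notation lo i := (widen_ord (leqnSn m.+1) i).
Local Notation hi i := (lift ord0 i).
Hypotheses (q0 : (q%:R : k) != 0) (sqE : sq ^+ 2 = q%:R).
Hypothesis relH : hecke_rels q T X Xi.
Local Notation Tinv := (Tinv q T).
Local Notation Ttau := (Ttau T X sq).
Local Notation Ttaui := (Ttaui q T Xi sq).
Local Notation Ts0 := (Ts0 q T X Xi).
Local Notation Tgen := (Tgen q T X Xi).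
Local Notation Ttaupow := (Ttaupow q T X Xi sq).
Local Notation Taff := (Taff q T X Xi sq).

Lemma natr_mull (x : H) : q%:R * x = (q%:R : k) *: x.
Proof. by rewrite mulr_natl scaler_nat. Qed.

Lemma T_quad i : T i * T i = (q%:R - 1 : k) *: T i + (q%:R : k) *: 1.
Proof.
have [quad _] := relH; have := quad i; rewrite mulrDr mulr1 mulrBl natr_mull => e.
rewrite -[q%:R *: 1]natr_mull mulr1 scalerBl scale1r; apply/eqP; rewrite -subr_eq0 -e.
by rewrite opprD opprB !addrA (addrAC _ (T i)).
Qed.

Lemma T_comm (i j : 'I_m.+1) : (i.+1 < j)%N || (j.+1 < i)%N -> T i * T j = T j * T i.
Proof. by case: relH => _ [h _]; apply: h. Qed.

Lemma T_braid (i j : 'I_m.+1) : (j : nat) = i.+1 -> T i * T j * T i = T j * T i * T j.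
Proof. by case: relH => _ [_ [h _]]; apply: h. Qed.

Lemma XXi j : X j * Xi j = 1.
Proof. by case: relH => _ [_ [_ [h _]]]; case: (h j). Qed.

Lemma XiX j : Xi j * X j = 1.
Proof. by case: relH => _ [_ [_ [h _]]]; case: (h j). Qed.

Lemma X_comm j j' : X j * X j' = X j' * X j.
Proof. by case: relH => _ [_ [_ [_ [h _]]]]; apply: h. Qed.

Lemma TX_comm (i : 'I_m.+1) j : j != lo i -> j != hi i -> T i * X j = X j * T i.
Proof. by case: relH => _ [_ [_ [_ [_ [h _]]]]]; apply: h. Qed.

Lemma TXT i : T i * X (lo i) * T i = (q%:R : k) *: X (hi i).
Proof. by rewrite -natr_mull; case: relH => _ [_ [_ [_ [_ [_ h]]]]]; apply: h. Qed.

Lemma TinvE i : Tinv i = (q%:R : k)^-1 *: (T i - (q%:R - 1 : k) *: 1).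
Proof. by rewrite /Defs.Tinv scalerBl scale1r -natr_mull mulr1. Qed.

Lemma TTinv i : T i * Tinv i = 1.
Proof.
rewrite TinvE -scalerAr mulrBr T_quad -scalerAr mulr1 addrAC subrr add0r.
by rewrite scalerA mulVf // scale1r.
Qed.

Lemma TinvT i : Tinv i * T i = 1.
Proof.
rewrite TinvE -scalerAl mulrBl T_quad -scalerAl mul1r addrAC subrr add0r.
by rewrite scalerA mulVf // scale1r.
Qed.

Lemma TX_Tinv i : T i * X (lo i) = (q%:R : k) *: (X (hi i) * Tinv i).
Proof. by rewrite scalerAl -TXT -[RHS]mulrA TTinv mulr1. Qed.

(** Indices become natural numbers so that products can be treated by recursion on their length;
    [cT a b] is the descending product from index [a + b - 1] down to [a], and [cV a b] the same
    product of inverses. *)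
Let TN (i : nat) : H := T (inord i).
Let VN (i : nat) : H := Tinv (inord i).
Let XN (j : nat) : H := X (inord j).
Let cT (a b : nat) : H := \prod_(i <- rev (iota a b)) TN i.
Let cV (a b : nat) : H := \prod_(i <- rev (iota a b)) VN i.

Let cTS a b : cT a b.+1 = TN (a + b) * cT a b.
Proof. by rewrite /cT -[b.+1]addn1 iotaD rev_cat big_cat /= big_seq1. Qed.

Let cVS a b : cV a b.+1 = VN (a + b) * cV a b.
Proof. by rewrite /cV -[b.+1]addn1 iotaD rev_cat big_cat /= big_seq1. Qed.

Let cT_recr b : cT 0 b.+1 = cT 1 b * TN 0.
Proof. by rewrite /cT /= rev_cons -cats1 big_cat big_seq1. Qed.

Let TN_comm i j : (i.+1 < j)%N -> (j <= m)%N -> TN i * TN j = TN j * TN i.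
Proof.
by move=> ij jm; apply: T_comm; rewrite !inordK ?ij //; lia.
Qed.

Let TN_braid i : (i < m)%N -> TN i * TN i.+1 * TN i = TN i.+1 * TN i * TN i.+1.
Proof. by move=> im; apply: T_braid; rewrite !inordK //; lia. Qed.

Let TX_N i j : (i <= m)%N -> (j <= m.+1)%N -> j != i -> j != i.+1 -> TN i * XN j = XN j * TN i.
Proof.
by move=> im jm ji jSi; apply: TX_comm; rewrite -val_eqE /= ?/bump /= !inordK //.
Qed.

Let lo_inord i : (i <= m)%N -> lo (inord i : 'I_m.+1) = inord i.
Proof. by move=> im; apply: val_inj; rewrite /= !inordK // ltnS ltnW. Qed.

Let hi_inord i : (i <= m)%N -> hi (inord i : 'I_m.+1) = inord i.+1.
Proof. by move=> im; apply: val_inj; rewrite /= /bump /= !inordK. Qed.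

Let TX_inv i : (i <= m)%N -> TN i * XN i = (q%:R : k) *: (XN i.+1 * VN i).
Proof. by move=> im; rewrite /XN -lo_inord // TX_Tinv hi_inord. Qed.

Let TXT_N i : (i <= m)%N -> TN i * XN i * TN i = (q%:R : k) *: XN i.+1.
Proof. by move=> im; rewrite /XN -lo_inord // TXT hi_inord. Qed.

Let cT_commR b j : (b <= j)%N -> (j < m)%N -> cT 0 b * TN j.+1 = TN j.+1 * cT 0 b.
Proof.
elim: b => [|b IH] bj jm; first by rewrite /cT big_nil mul1r mulr1.
by rewrite cTS -mulrA IH // ?(ltnW bj) // !mulrA TN_comm.
Qed.

Let cT_shift b j : (j.+1 < b)%N -> (b <= m.+1)%N -> cT 0 b * TN j.+1 = TN j * cT 0 b.
Proof.
elim: b => // b IH; rewrite ltnS leq_eqVlt => /orP[/eqP <- bm|jb bm].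
  rewrite !cTS !add0n -!mulrA cT_commR // !mulrA; congr (_ * _).
  by rewrite TN_braid.
rewrite cTS add0n -mulrA IH // ?(ltnW bm) // !mulrA; congr (_ * _).
by rewrite -(TN_comm jb).
Qed.

Let cT_X0 b : (b <= m)%N -> cT 1 b * XN 0 = XN 0 * cT 1 b.
Proof.
elim: b => [|b IH] bm; first by rewrite /cT big_nil mul1r mulr1.
by rewrite cTS -mulrA IH ?(ltnW bm) // !mulrA TX_N.
Qed.

Let VX_N i : (0 < i <= m)%N -> VN i * XN 0 = XN 0 * VN i.
Proof.
move=> /andP[i0 im]; have e : TN i * XN 0 = XN 0 * TN i by apply: TX_N => //; lia.
rewrite -[LHS]mulr1 -(TTinv (inord i)) -/(TN i) -/(VN i) -!mulrA (mulrA (XN 0)) -e.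
by rewrite !mulrA TinvT mul1r.
Qed.

Let cV_X0 b : (b <= m)%N -> cV 1 b * XN 0 = XN 0 * cV 1 b.
Proof.
elim: b => [|b IH] bm; first by rewrite /cV big_nil mul1r mulr1.
by rewrite cVS -mulrA IH ?(ltnW bm) // !mulrA VX_N.
Qed.

Let cT_X1 b : (b <= m)%N -> cT 1 b * XN 1 = (q%:R : k) ^+ b *: (XN b.+1 * cV 1 b).
Proof.
elim: b => [|b IH] bm; first by rewrite /cT /cV !big_nil mul1r mulr1 scale1r.
rewrite cTS -mulrA IH ?(ltnW bm) // -scalerAr mulrA add1n TX_inv // -scalerAl scalerA.
by rewrite -exprSr cVS mulrA add1n.
Qed.

Let cT_down b : (b <= m)%N -> cT 0 m.+1 * cT 1 b = cT 0 b * cT 0 m.+1.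
Proof.
elim: b => [|b IH] bm; first by rewrite /cT !big_nil mul1r mulr1.
by rewrite (cTS 1) (cTS 0 b) mulrA add1n cT_shift // -!mulrA IH // ltnW.
Qed.

Let prod_enum (F : 'I_m.+1 -> H) :
  \prod_(i <- rev (enum 'I_m.+1)) F i = \prod_(i <- rev (iota 0 m.+1)) F (inord i).
Proof.
rewrite -val_enum_ord -map_rev big_map; apply: eq_bigr => i _.
by rewrite inord_val.
Qed.

Let TtauE : Ttau = sq^-1 ^+ m.+1 *: (cT 0 m.+1 * XN 0).
Proof.
rewrite /Defs.Ttau prod_enum; congr (_ *: (_ * X _)).
by apply: val_inj; rewrite /= inordK.
Qed.

Lemma prod_TinvT (r : seq 'I_m.+1) :
  (\prod_(i <- r) Tinv i) * \prod_(i <- rev r) T i = 1.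
Proof.
elim: r => [|i r IH]; first by rewrite !big_nil mul1r.
rewrite rev_cons -cats1 big_cat big_seq1 big_cons -!mulrA (mulrA (\prod_(j <- r) _)) IH mul1r.
exact: TinvT.
Qed.

Lemma prod_TTinv (r : seq 'I_m.+1) :
  (\prod_(i <- rev r) T i) * \prod_(i <- r) Tinv i = 1.
Proof.
elim: r => [|i r IH]; first by rewrite !big_nil mul1r.
by rewrite rev_cons -cats1 big_cat big_seq1 big_cons /= -!mulrA (mulrA (T i)) TTinv mul1r.
Qed.

Lemma sq_neq0 : sq != 0.
Proof. by apply: contra q0 => /eqP e; rewrite -sqE e expr0n. Qed.

Lemma TtauK : Ttau * Ttaui = 1.
Proof.
rewrite /Defs.Ttau /Defs.Ttaui -scalerAl -scalerAr scalerA -exprMn mulVf ?sq_neq0 //.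
rewrite expr1n scale1r -!mulrA (mulrA (X _)) XXi mul1r.
exact: prod_TTinv.
Qed.

Lemma TtauVK : Ttaui * Ttau = 1.
Proof.
rewrite /Defs.Ttau /Defs.Ttaui -scalerAl -scalerAr scalerA -exprMn mulfV ?sq_neq0 //.
rewrite expr1n scale1r -!mulrA (mulrA (\prod_(i <- enum _) _)) prod_TinvT mul1r.
exact: XiX.
Qed.

(** With 0-based indices, [T_0 X_0 T_0 = q X_1], and then each relation [T_i X_i = q X_{i+1} T_i^-1]
    pushes the variable one position further, up to the last one. The powers of [q] add up to the
    scalar in [Ts0]. *)
Let Ttau_T0 : Ttau * TN 0 = Ts0 * Ttau.
Proof.
rewrite {1}TtauE -scalerAl /Defs.Ttau -scalerAr; congr (_ *: _).
rewrite /Defs.Ts0 /word0 rev_cat revK big_cat -scalerAl -!mulrA.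
rewrite (mulrA (\prod_(i <- enum _) _)) prod_TinvT mul1r.
have -> : \prod_(i <- rev (behead (enum 'I_m.+1))) Tinv i = cV 1 m.
  rewrite /cV -[iota 1 m]/(behead (iota 0 m.+1)) -val_enum_ord behead_map -map_rev.
  by rewrite big_map; apply: eq_bigr => i _; rewrite /VN inord_val.
have x0 : X ord0 = XN 0 by congr X; apply: val_inj; rewrite /= inordK.
have xm : X ord_max = XN m.+1 by congr X; apply: val_inj; rewrite /= inordK.
rewrite x0 xm cV_X0 // cT_recr -!mulrA (mulrA (TN 0)) TXT_N //.
rewrite -scalerAr cT_X1 // scalerA -exprS; congr (_ *: _).
by rewrite (mulrA (XN m.+1) (XN 0)) [XN m.+1 * XN 0]X_comm !mulrA -/(XN 0) -x0 XiX mul1r.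
Qed.

(** The wrap-around relation is first proved for the square of [Ttau] by [rot_square]; [Ttau_T0]
    then introduces [Ts0], and one factor [Ttau] is cancelled. *)
Let Ttau_Ts0 : Ttau * Ts0 = TN m * Ttau.
Proof.
have E : Ttau * Ttau * TN 0 = TN m * Ttau * Ttau.
  rewrite TtauE -!scalerAl -!scalerAr -!scalerAl; congr (_ *: (_ *: _)).
  apply: (@rot_square _ _ (cT 1 m) (cT 0 m) (TN 0) (XN 0) (q%:R *: XN 1)) => //.
  - exact: cT_X0.
  - exact: TXT_N.
  - by rewrite -scalerAl -scalerAr /XN X_comm.
  - exact: cT_down.
rewrite -[LHS]mulr1 -TtauK !mulrA -[Ttau * Ts0 * Ttau]mulrA -Ttau_T0 mulrA E.
by rewrite -!mulrA TtauK mulr1.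
Qed.

Lemma Ttau_Tgen i : Ttau * Tgen i = Tgen (ord_pred i) * Ttau.
Proof.
have gen j : (j <= m)%N -> Tgen (inord j.+1) = TN j.
  by move=> jm; rewrite -hi_inord // /Defs.Tgen liftK.
case: (unliftP ord0 i) => [j ->|->]; last first.
  have -> : ord_pred ord0 = inord m.+1 :> 'I_n.
    by apply: val_inj; rewrite /= inordK // modn_small.
  by rewrite gen // /Defs.Tgen unlift_none Ttau_Ts0.
have jm : (j <= m)%N by rewrite -ltnS.
rewrite -[j]inord_val hi_inord // gen //.
case: (posnP (j : nat)) => [j0|j0].
  have -> : ord_pred (inord j.+1) = ord0 :> 'I_n.
    apply: (@ordS_inj _); rewrite ord_predK.
    by apply: val_inj; rewrite /= j0 inordK // modn_small.
  by rewrite j0 Ttau_T0 /Defs.Tgen unlift_none.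
have -> : ord_pred (inord j.+1) = inord j.-1.+1 :> 'I_n.
  apply: (@ordS_inj _); rewrite ord_predK prednK //.
  have jm1 : (j < n)%N by rewrite ltnS ltnW.
  by apply: val_inj; rewrite /= (inordK jm1) modn_small ?inordK.
rewrite gen; last by lia.
rewrite TtauE -scalerAl -scalerAr; congr (_ *: _).
rewrite -mulrA -TX_N //; last by rewrite neq_ltn j0.
by rewrite !mulrA -[in LHS](prednK j0) cT_shift //; lia.
Qed.

Lemma Ttaupow_S j : Ttau * Ttaupow j = Ttaupow (j + 1).
Proof.
case: j => [a|a]; first by rewrite -PoszD addn1 /= exprS.
rewrite NegzE; case: a => [|a]; first by rewrite /= TtauK.
have -> : - a.+2%:Z + 1 = Negz a by lia.
by rewrite -NegzE /= [Ttaui ^+ a.+2]exprS mulrA TtauK mul1r.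
Qed.

Lemma Ttaupow_B j : Ttaui * Ttaupow j = Ttaupow (j - 1).
Proof. by rewrite -{1}[j](subrK 1) -Ttaupow_S mulrA TtauVK mul1r. Qed.

End HeckeRelations.

(** * Matsumoto's theorem and products with additive lengths *)

Section Matsumoto.
Variables (m : nat) (k : fieldType) (q : nat) (sq : k) (H : algType k).
Variables (T : 'I_m.+1 -> H) (X Xi : 'I_m.+2 -> H).
Local Notation n := m.+2.
Local Notation lo i := (widen_ord (leqnSn m.+1) i).
Local Notation hi i := (lift ord0 i).
Hypotheses (q0 : (q%:R : k) != 0) (sqE : sq ^+ 2 = q%:R).
Hypothesis relH : hecke_rels q T X Xi.
Local Notation Ttau := (Ttau T X sq).
Local Notation Ttaui := (Ttaui q T Xi sq).
Local Notation Tgen := (Tgen q T X Xi).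
Local Notation Ttaupow := (Ttaupow q T X Xi sq).
Local Notation Taff := (Taff q T X Xi sq).
Local Notation Tfin := (Tfin T).
Implicit Types (w x y : Wt m).

(** The rank-two case of Matsumoto's theorem: at a common descent the longest element of the
    dihedral group on the two letters splits off [w]. For [n = 2] that group is infinite, but no [w]
    has both descents. *)
Definition braided (i i' : 'I_n) : Prop := forall w, dsc w i -> dsc w i' ->
  [\/ [/\ dsc (wmul (saff i) w) i',
          wmul (saff i) (saff i') = wmul (saff i') (saff i) :> Wt m
        & Tgen i * Tgen i' = Tgen i' * Tgen i]
    | [/\ dsc (wmul (saff i) w) i', dsc (wmul (saff i') (wmul (saff i) w)) i,
          wmul (saff i) (wmul (saff i') (saff i)) =
          wmul (saff i') (wmul (saff i) (saff i')) :> Wt m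
        & Tgen i * Tgen i' * Tgen i = Tgen i' * Tgen i * Tgen i']].

Lemma Tgen_hi j : Tgen (hi j) = T j.
Proof. by rewrite /Defs.Tgen liftK. Qed.

Lemma iwin_sfin_inord (w : Wt m) (a : 'I_m.+1) j : (j < n)%N ->
  iwin (wmul (fW (sfin a)) w) (inord j) =
  iwin w (inord (if j == a then a.+1 else if j == a.+1 then a : nat else j)).
Proof.
move=> jn; rewrite iwin_sfin; congr iwin; apply: val_inj; rewrite /= sfinE inordK //.
by have la := ltn_ord a; rewrite inordK //; repeat case: ifP => ?; lia.
Qed.

Lemma dsc_inord (w : Wt m) (a : 'I_m.+1) :
  dsc w (hi a) = (iwin w (inord a.+1) < iwin w (inord a)).
Proof.
have la := ltn_ord a; rewrite dsc_fin.
have -> : hi a = inord a.+1 by apply: val_inj; rewrite /= inordK.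
by have -> : lo a = inord a by apply: val_inj; rewrite /= inordK // ltnW.
Qed.

Lemma sfin_comm (a b : 'I_m.+1) : (a.+1 < b)%N || (b.+1 < a)%N ->
  (sfin a * sfin b)%g = (sfin b * sfin a)%g.
Proof.
move=> ab; apply/permP => c; apply: val_inj; rewrite !permM /= !sfinE.
by repeat case: ifP; lia.
Qed.

Lemma sfin_braid (a b : 'I_m.+1) : (b : nat) = a.+1 ->
  (sfin a * sfin b * sfin a)%g = (sfin b * sfin a * sfin b)%g.
Proof.
move=> ab; apply/permP => c; apply: val_inj; rewrite !permM /= !sfinE ab.
by repeat case: ifP; lia.
Qed.

Lemma braided_fin (a b : 'I_m.+1) : a != b -> braided (hi a) (hi b).
Proof.
rewrite -val_eqE /= => ab w; have la := ltn_ord a; have lb := ltn_ord b.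
rewrite !Tgen_hi !saff_hi !dsc_inord => da db.
have [far|near] := boolP ((a.+1 < b) || (b.+1 < a))%N.
  left; rewrite !fWM (sfin_comm far) (T_comm relH far); split=> //.
  have [la2 lb2] : (b.+1 < n)%N /\ (b < n)%N by lia.
  by rewrite !iwin_sfin_inord //; repeat case: ifP => ?; lia.
have E c d j (jn : (j < n)%N) := iwin_sfin_inord (wmul (fW (sfin c)) w) d jn.
right; have [ba|ba] : (b : nat) = a.+1 \/ (a : nat) = b.+1 by lia.
  have [h1 [h2 h3]] : (a.+2 < n)%N /\ (a.+1 < n)%N /\ (a < n)%N by lia.
  rewrite ba in db *; split.
  - by rewrite !iwin_sfin_inord //; repeat case: ifP => ?; lia.
  - rewrite !E // !ba !eqxx.
    have -> : ((a : nat) == a.+1) = false by lia.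
    have -> : ((a : nat) == a.+2) = false by lia.
    by rewrite !iwin_sfin_inord //; repeat case: ifP => ?; lia.
  - by rewrite !fWM (sfin_braid ba).
  - exact: (T_braid relH).
have [h1 [h2 h3]] : (b.+2 < n)%N /\ (b.+1 < n)%N /\ (b < n)%N by lia.
rewrite ba in da *; split.
- by rewrite !iwin_sfin_inord // ba; repeat case: ifP => ?; lia.
- rewrite !E // !eqxx.
  do ?[have -> : (b.+1 == b) = false by lia].
  do ?[have -> : (b.+2 == b) = false by lia].
  do ?[have -> : (b.+2 == b.+1) = false by lia].
  by rewrite !iwin_sfin_inord // ba; repeat case: ifP => ?; lia.
- by rewrite !fWM (sfin_braid ba).
- by rewrite (T_braid relH ba).
Qed.

Lemma saff_pred i : saff (ord_pred i) = wmul (wmul (tau m) (saff i)) (winv (tau m)).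
Proof. by rewrite tau_saff wmulwK. Qed.

Lemma Tgen_pred i : Tgen (ord_pred i) = Ttau * Tgen i * Ttaui.
Proof.
by rewrite (Ttau_Tgen q0 sqE relH) -mulrA (TtauK q0 sqE relH) mulr1.
Qed.

Lemma braided_pred i i' : braided i i' -> braided (ord_pred i) (ord_pred i').
Proof.
move=> h w; rewrite -[w](wmulKVw (tau m)); move: (wmul (winv _) w) => {}w.
rewrite !dsc_tau => di di'.
have E a x : wmul (saff (ord_pred a)) (wmul (tau m) x) = wmul (tau m) (wmul (saff a) x).
  by rewrite (wmulA _ (tau m)) -tau_saff -(wmulA (tau m)).
have F (a b : H) : Ttau * a * Ttaui * (Ttau * b * Ttaui) = Ttau * (a * b) * Ttaui.
  by rewrite -!mulrA (mulrA Ttaui) (TtauVK q0 sqE relH) mul1r.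
have G (t a b : Wt m) : wmul (wmul (wmul t a) (winv t)) (wmul (wmul t b) (winv t))
    = wmul (wmul t (wmul a b)) (winv t).
  by rewrite -!wmulA wmulKw.
case: (h w di di') => [[h1 h2 h3]|[h1 h2 h3 h4]]; [left|right].
  by rewrite !E dsc_tau !saff_pred !Tgen_pred !F !G h2 h3.
by rewrite !E !dsc_tau !saff_pred !Tgen_pred !F !G h3 h4.
Qed.

(** For [n > 2], at most two rotations make both indices nonzero, and [braided_fin] applies. For
    [n = 2] the two descent inequalities contradict each other. *)
Lemma braided_all i i' : i != i' -> braided i i'.
Proof.
have fin (a b : 'I_n) : a != b -> a != ord0 -> b != ord0 -> braided a b.
  case: (unliftP ord0 a) => [a' ->|->] //; case: (unliftP ord0 b) => [b' ->|->] //.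
  by rewrite (inj_eq lift_inj) => ab _ _; apply: braided_fin.
move=> ii'; have [m0|m0] := posnP m.
  have no w : dsc w ord0 -> dsc w ord_max -> False.
    have -> : ord_max = hi ord0 :> 'I_n by apply: val_inj; rewrite /= m0.
    rewrite dsc0 dsc_fin.
    have -> : ord_max = hi ord0 :> 'I_n by apply: val_inj; rewrite /= m0.
    have -> : lo ord0 = ord0 by apply: val_inj.
    by lia.
  have two (a : 'I_n) : a = ord0 \/ a = ord_max.
    have la := ltn_ord a.
    have [e|e] : (a : nat) = 0%N \/ (a : nat) = 1%N by lia.
      by left; apply: val_inj.
    by right; apply: val_inj => /=; lia.
  move=> w di di'; exfalso; case: (two i) (two i') di di' ii' => -> [] ->; rewrite ?eqxx //.
    by move=> d0 d1 _; apply: no d0 d1.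
  by move=> d1 d0 _; apply: no d0 d1.
have rotS a b : braided (ordS a) (ordS b) -> braided a b.
  by move=> /braided_pred; rewrite !ordSK.
have S0 (a : 'I_n) : (ordS a == ord0) = (a == ord_max) by rewrite ordS_eq -val_eqE.
have SS (a b : 'I_n) : a != b -> ordS a != ordS b by rewrite (inj_eq (@ordS_inj _)).
have nm : (ord0 == ord_max :> 'I_n) = false by [].
have n1 : (ordS ord0 == ord_max :> 'I_n) = false.
  by rewrite -val_eqE /= modn_small //; lia.
have Sm : ordS ord_max = ord0 :> 'I_n by apply/eqP; rewrite S0.
have n2 : ordS (ordS ord0) != ordS ord0 :> 'I_n.
  by rewrite (inj_eq (@ordS_inj _)) S0 nm.
have [i0|i0] := eqVneq i ord0.
  rewrite i0 in ii' *; have [->|i1] := eqVneq i' ord_max.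
    refine (rotS _ _ _); rewrite Sm; refine (rotS _ _ (fin _ _ n2 _ _)); rewrite S0 ?n1 ?nm //.
  by refine (rotS _ _ (fin _ _ (SS _ _ ii') _ _)); rewrite S0 ?nm.
have [i0'|i0'] := eqVneq i' ord0; last exact: fin.
rewrite i0' in ii' *; have [->|i1] := eqVneq i ord_max.
  refine (rotS _ _ _); rewrite Sm; rewrite eq_sym in n2.
  by refine (rotS _ _ (fin _ _ n2 _ _)); rewrite S0 ?n1 ?nm.
by refine (rotS _ _ (fin _ _ (SS _ _ ii') _ _)); rewrite S0 ?nm.
Qed.

Definition Tword (r : seq 'I_n) j : H := \prod_(i <- r) Tgen i * Ttaupow j.

Lemma Tword_cons i r j : Tword (i :: r) j = Tgen i * Tword r j.
Proof. by rewrite /Tword big_cons mulrA. Qed.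

Lemma aword_dsc i r j : size (i :: r) = alen (aword (i :: r) j : Wt m) ->
  dsc (aword (i :: r) j : Wt m) i /\ size r = alen (aword r j : Wt m).
Proof.
rewrite aword_cons => e; have le := alen_aword r j; rewrite /= in e.
have e' : size r = alen (aword r j : Wt m).
  apply/eqP; rewrite eqn_leq le andbT -ltnS [X in (X <= _)%N]e.
  exact: alen_saff_le.
by split=> //; rewrite dscE saffK -e e'.
Qed.

(** Words with different first letters are compared through words that start with the two sides of
    the commutation or braid relation, followed by a common reduced word [t]. Each comparison is an
    instance of the induction after removal of a shared first letter. *)
Lemma matsumoto r j r' j' : aword r j = aword r' j' :> Wt m ->
  size r = alen (aword r j : Wt m) -> size r' = alen (aword r' j' : Wt m) ->
  Tword r j = Tword r' j'.
Proof.
have [N] := ubnP (size r); elim: N r j r' j' => // N IH r j r' j' sN e sr sr'.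
have ss : size r' = size r by rewrite sr sr' e.
case: r r' e sr sr' ss sN => [|i r] [|i' r'] //.
  rewrite /aword /= !wmul1w => e _ _ _ _; congr (Tword _ _).
  by have := iwin_tau_pow j (ord0 : 'I_n); rewrite e iwin_tau_pow => /addrI.
move=> e sr sr' _ sN.
have [di er] := aword_dsc sr; have [di' er'] := aword_dsc sr'.
have [ei|ni] := eqVneq i i'.
  rewrite !Tword_cons ei; congr (_ * _); apply: IH => //.
  by move: e; rewrite !aword_cons ei => /wmulIw.
set w := aword (i :: r) j in e di; rewrite -e in di'.
have ew : wmul (saff i) w = aword r j by rewrite /w aword_cons saffK.
have ew' : wmul (saff i') w = aword r' j' by rewrite e aword_cons saffK.
have lw : alen w = (size r).+1 by rewrite -sr.
have sr1 : (size r < N)%N by [].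
have lw' : size r' = size r by apply: eq_add_S; rewrite -[(size r').+1]/(size (i' :: r')) sr' -e -sr.
have step a v : dsc v a -> alen (wmul (saff a) v) = (alen v).-1.
  by move=> /alen_saff_down ->.
rewrite !Tword_cons; case: (braided_all ni di di') => [[h1 h2 h3]|[h1 h2 h3 h4]].
  have [t [c [et st]]] := ex_reduced (wmul (saff i') (wmul (saff i) w)).
  have st' : (size t).+1 = size r.
    by rewrite st -alen_saff_down // step // lw.
  have -> : Tword r j = Tword (i' :: t) c.
    apply: IH => //; first by rewrite aword_cons et saffK ew.
    by rewrite aword_cons et saffK ew -er /= st'.
  have e2 : aword (i :: t) c = aword r' j'.
    by rewrite aword_cons et (wmulA (saff i')) -h2 -(wmulA (saff i)) saffK ew'.
  have -> : Tword r' j' = Tword (i :: t) c.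
    apply: IH => //; first by rewrite lw'.
    by rewrite e2 -er' lw'.
  by rewrite !Tword_cons !mulrA h3.
have [t [c [et st]]] := ex_reduced (wmul (saff i) (wmul (saff i') (wmul (saff i) w))).
have st' : (size t).+2 = size r.
  by rewrite st -alen_saff_down // -alen_saff_down // step // lw.
have -> : Tword r j = Tword (i' :: i :: t) c.
  by apply: IH => //; rewrite !aword_cons et !saffK ew // -er /= st'.
have e2 : aword (i :: i' :: t) c = aword r' j'.
  rewrite !aword_cons et -ew'.
  have -> : wmul (saff i) (wmul (saff i') (wmul (saff i) w)) =
            wmul (saff i') (wmul (saff i) (wmul (saff i') w)).
    by rewrite (wmulA (saff i')) (wmulA (saff i)) h3 -!(wmulA (saff _)).
  by rewrite !saffK.
have -> : Tword r' j' = Tword (i :: i' :: t) c.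
  apply: IH => //; first by rewrite lw'.
  by rewrite e2 -er' lw'.
by rewrite !Tword_cons !mulrA h4.
Qed.

(** This frees [Taff] from the reduced word chosen in its definition. *)
Lemma Taff_word r j w : aword r j = w -> size r = alen w -> Taff w = Tword r j.
Proof.
move=> e sr; rewrite /Defs.Taff; case: excluded_middle_informative => [ex|]; last first.
  by case; exists (r, j); apply/areducedE.
case: constructive_indefinite_description => -[r' j'] /= /areducedE[e' s'].
by apply: matsumoto; rewrite ?e' ?e.
Qed.

Lemma Taff_saff w i : ~~ dsc w i -> Taff (wmul (saff i) w) = Tgen i * Taff w.
Proof.
move=> nd; have [r [j [e s]]] := ex_reduced w.
rewrite (Taff_word e s) -Tword_cons; apply: Taff_word; first by rewrite aword_cons e.
by rewrite alen_saff_up //= s.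
Qed.

Lemma Taff_tau w : Taff (wmul (tau m) w) = Ttau * Taff w.
Proof.
have [r [j [e s]]] := ex_reduced w; rewrite (Taff_word e s).
rewrite (@Taff_word [seq ord_pred i | i <- r] (j + 1)); last first.
- by rewrite size_map alen_tau.
- rewrite -e /aword -tau_powS (wmulA _ (tau m)) (wmulA (tau m)); congr wmul.
  elim: r {e s} => [|i r IH] /=; first by rewrite wmul1w wmulw1.
  by rewrite -(wmulA (saff _)) IH (wmulA (saff _)) -tau_saff -(wmulA (tau m)).
rewrite /Tword -Ttaupow_S // !mulrA; congr (_ * _).
elim: r {e s} => [|i r IH] /=; first by rewrite !big_nil mul1r mulr1.
by rewrite !big_cons -mulrA IH mulrA -(Ttau_Tgen q0 sqE relH) -mulrA.
Qed.

Lemma Taff_tau_pow j w : Taff (wmul (wpowz (tau m) j) w) = Ttaupow j * Taff w.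
Proof.
elim/int_rect: j w => [|a IH|a IH] w; first by rewrite wmul1w mul1r.
  by rewrite -[a.+1]addn1 PoszD -tau_powS -Ttaupow_S // -wmulA Taff_tau IH mulrA.
have -> : - a.+1%:Z = - a%:Z - 1 by lia.
rewrite -tau_powB -Ttaupow_B // -mulrA -IH -wmulA.
by rewrite -[in RHS](wmulKVw (tau m) (wmul (wpowz _ _) _)) Taff_tau mulrA (TtauVK q0 sqE relH) mul1r.
Qed.

Lemma Taff_mul x y : alen (wmul x y) = (alen x + alen y)%N ->
  Taff (wmul x y) = Taff x * Taff y.
Proof.
have [r [j [<-]]] := ex_reduced x; elim: r => [|i r IH] sr.
  rewrite /aword /= wmul1w Taff_tau_pow => _; congr (_ * _).
  rewrite (@Taff_word [::] j); first by rewrite /Tword big_nil mul1r.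
    by rewrite /aword /= wmul1w.
  by rewrite sr /aword /= wmul1w.
have [di er] := aword_dsc sr; rewrite -sr /= => e.
have le := alenM (aword r j) y; have := alen_saff_le (wmul (aword r j) y) i.
rewrite wmulA -aword_cons e addSn ltnS er => ge.
have e2 : alen (wmul (aword r j) y) = (alen (aword r j : Wt m) + alen y)%N.
  by apply/eqP; rewrite eqn_leq le ge.
rewrite aword_cons -wmulA !Taff_saff; first by rewrite -mulrA IH.
  by rewrite -dsc_saff -aword_cons.
by rewrite dscE wmulA -aword_cons e e2 -er addSn ltnNge leqnSn.
Qed.

(** A reduced word of a finite permutation remains reduced in the affine group. *)
Lemma Tfin_aff s : Tfin s = Taff (fW s).
Proof.
rewrite /Defs.Tfin; case: excluded_middle_informative => [ex|]; last first.
  by case; have [r [e sr]] := ex_freduced s; exists r; apply/freducedE.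
case: constructive_indefinite_description => r /= /freducedE[e sr].
rewrite (@Taff_word [seq hi i | i <- r] 0) ?aword_fin ?e ?size_map //.
rewrite /Tword mulr1 big_map; apply: eq_bigr => i _.
by rewrite Tgen_hi.
Qed.

Lemma Tfin1 : Tfin 1%g = 1.
Proof.
rewrite Tfin_aff (@Taff_word [::] 0); first by rewrite /Tword big_nil mulr1.
  by rewrite /aword /= wmul1w.
by rewrite alen1.
Qed.

Lemma T_Tfin_up i s : ~~ dsc (fW s) (hi i) -> T i * Tfin s = Tfin (s * sfin i)%g.
Proof. by move=> nd; rewrite !Tfin_aff -fWM -saff_hi Taff_saff // Tgen_hi. Qed.

Lemma T_Tfin_down i s : dsc (fW s) (hi i) ->
  T i * Tfin s = (q%:R - 1 : k) *: Tfin s + (q%:R : k) *: Tfin (s * sfin i)%g.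
Proof.
move=> ds; have e : s = ((s * sfin i) * sfin i)%g by rewrite -mulgA sfinK mulg1.
have nd : ~~ dsc (fW (s * sfin i)%g) (hi i) by rewrite -fWM -saff_hi dsc_saff ds.
rewrite {1 2}e -T_Tfin_up // mulrA (T_quad relH) mulrDl -!scalerAl mul1r.
by rewrite T_Tfin_up.
Qed.

Lemma Tfin_mul J s b : incr J (fW s) -> b \in WK J ->
  Tfin (b * s)%g = Tfin s * Tfin b.
Proof.
by move=> iJs bJ; rewrite !Tfin_aff -fWM Taff_mul // (alen_incr_mul iJs).
Qed.

Lemma Tfin_sfin i : Tfin (sfin i) = T i.
Proof.
rewrite -[sfin i]mul1g -T_Tfin_up ?Tfin1 ?mulr1 //.
by rewrite dscE alen1.
Qed.

End Matsumoto.

(** * The elements v_J and sums over cosets and double cosets *)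

Section ParabolicHecke.
Variables (m : nat) (k : fieldType) (q : nat) (sq : k) (H : algType k).
Variables (T : 'I_m.+1 -> H) (X Xi : 'I_m.+2 -> H).
Local Notation n := m.+2.
Local Notation lo i := (widen_ord (leqnSn m.+1) i).
Local Notation hi i := (lift ord0 i).
Hypotheses (q0 : (q%:R : k) != 0) (sqE : sq ^+ 2 = q%:R).
Hypothesis relH : hecke_rels q T X Xi.
Local Notation Taff := (Taff q T X Xi sq).
Local Notation Tfin := (Tfin T).
Local Notation vJ := (vJ T).
Implicit Types (s t u b : {perm 'I_n}) (K J : {set 'I_m.+1}).

Lemma Tfin_T_up i s : ~~ dsc (fW (s^-1)%g) (hi i) -> Tfin s * T i = Tfin (sfin i * s)%g.
Proof.
move=> nd; rewrite -(Tfin_sfin q0 sqE relH i) !(Tfin_aff q0 sqE relH) -fWM Taff_mul //.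
rewrite -alenV winvM !winv_fW sfinV -saff_hi alen_saff_up // -winv_fW alenV -addn1; congr addn.
have := alen_saff_up (w := wone m) (i := hi i); rewrite wmulw1 alen1 saff_hi => -> //.
by rewrite dscE alen1.
Qed.

Lemma Tfin_T_down i s : dsc (fW (s^-1)%g) (hi i) ->
  Tfin s * T i = (q%:R - 1 : k) *: Tfin s + (q%:R : k) *: Tfin (sfin i * s)%g.
Proof.
move=> ds; have e : s = (sfin i * (sfin i * s))%g by rewrite mulgA sfinK mul1g.
have nd : ~~ dsc (fW ((sfin i * s)^-1)%g) (hi i).
  by rewrite invMg sfinV -fWM -saff_hi dsc_saff ds.
rewrite {1 2}e -Tfin_T_up // -mulrA (T_quad relH) mulrDr -!scalerAr mulr1.
by rewrite Tfin_T_up.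
Qed.

(** [W_J] splits into pairs exchanged by left multiplication with [s_i]. If [A] and [B] sum over the
    shorter and the longer members, then [T_i A = B] and [T_i B = (q - 1) B + q A]. *)
Lemma T_vJ i J : i \in J -> T i * vJ J = (q%:R : k) *: vJ J.
Proof.
move=> iJ; rewrite /Defs.vJ (bigID (fun w => dsc (fW w) (hi i))) /=.
set B := \sum_(w in _ | dsc _ _) _; set A := \sum_(w in _ | ~~ _) _.
have inJ w : (w * sfin i \in WK J)%g = (w \in WK J) by rewrite groupMr ?sfin_WK.
have dn w : dsc (fW (w * sfin i)%g) (hi i) = ~~ dsc (fW w) (hi i).
  by rewrite -fWM -saff_hi dsc_saff.
have TA : T i * A = B.
  rewrite mulr_sumr /B [RHS](reindex_inj (mulIg (sfin i))) /=.
  apply: eq_big => [w|w /andP[_ /(T_Tfin_up q0 sqE relH)]//].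
  by rewrite inJ dn.
have TB : T i * B = (q%:R - 1 : k) *: B + (q%:R : k) *: A.
  rewrite {1}/B mulr_sumr; under eq_bigr => w /andP[_ /(T_Tfin_down q0 sqE relH)->] do [].
  rewrite big_split /= -!scaler_sumr; congr (_ + _ *: _).
  rewrite /A [RHS](reindex_inj (mulIg (sfin i))) /=; apply: eq_bigl => w.
  by rewrite inJ dn negbK.
rewrite mulrDr TA TB scalerBl scale1r scalerDr addrAC subrK //.
Qed.

Lemma vJ_T i J : i \in J -> vJ J * T i = (q%:R : k) *: vJ J.
Proof.
move=> iJ; rewrite /Defs.vJ (bigID (fun w => dsc (fW (w^-1)%g) (hi i))) /=.
set B := \sum_(w in _ | dsc _ _) _; set A := \sum_(w in _ | ~~ _) _.
have inJ w : (sfin i * w \in WK J)%g = (w \in WK J) by rewrite groupMl ?sfin_WK.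
have dn w : dsc (fW ((sfin i * w)^-1)%g) (hi i) = ~~ dsc (fW (w^-1)%g) (hi i).
  by rewrite invMg sfinV -fWM -saff_hi dsc_saff.
have TA : A * T i = B.
  rewrite mulr_suml /B [RHS](reindex_inj (mulgI (sfin i))) /=.
  apply: eq_big => [w|w /andP[_ /Tfin_T_up]//].
  by rewrite inJ dn.
have TB : B * T i = (q%:R - 1 : k) *: B + (q%:R : k) *: A.
  rewrite {1}/B mulr_suml; under eq_bigr => w /andP[_ /Tfin_T_down->] do [].
  rewrite big_split /= -!scaler_sumr; congr (_ + _ *: _).
  rewrite /A [RHS](reindex_inj (mulgI (sfin i))) /=; apply: eq_bigl => w.
  by rewrite inJ dn negbK.
rewrite mulrDl TA TB scalerBl scale1r scalerDr addrAC subrK //.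
Qed.

Lemma perm_coset_eq J :
  perm_eq (enum {perm 'I_n})
    [seq (b * s)%g | s <- enum [set s : {perm 'I_n} | incr J (fW s)], b <- enum (WK J)].
Proof.
apply: uniq_perm; first exact: enum_uniq.
  apply: allpairs_uniq; rewrite ?enum_uniq // => -[s b] [s' b'].
  move=> /allpairsP[[s1 b1] [/= i1 b1J [-> ->]]] /allpairsP[[s2 b2] [/= i2 b2J [-> ->]]] /= e.
  move: i1 b1J i2 b2J; rewrite !mem_enum !inE => i1 b1J i2 b2J.
  have e' : s2 = (b2^-1 * b1 * s1)%g by rewrite -mulgA e mulgA mulVg mul1g.
  have b12 : (b2^-1 * b1)%g = 1%g.
    by apply: (incr_uniq i1); rewrite ?fWM -?e' // groupM ?groupV.
  rewrite e' b12 mul1g; congr (_, _).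
  by apply: (mulgI (b2^-1)%g); rewrite b12 mulVg.
move=> s; rewrite mem_enum; apply/esym/allpairsP.
have [b bJ ib] := ex_incr J (fW s); rewrite fWM in ib.
by exists ((b * s)%g, (b^-1)%g); rewrite /= !mem_enum inE ib groupV mulKg.
Qed.

Lemma sum_coset (V : nmodType) J (F : {perm 'I_n} -> V) :
  \sum_s F s = \sum_(s | incr J (fW s)) \sum_(b in WK J) F (b * s)%g.
Proof.
rewrite -big_enum (perm_big _ (perm_coset_eq J)) big_allpairs_dep /= big_enum /=.
by apply: eq_big => [s|s _]; rewrite ?inE ?big_enum.
Qed.

(** Each [v] is [a d b] with lengths adding up, so [T_v = T_a T_d T_b]. Summing over [b] in [W_J]
    produces [vJ J], and what remains is the operator of the theorem. *)
Lemma sum_dcoset K J d : Dcos K J d ->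
  \sum_(v <- dcoset K J d) Taff v =
  (\sum_(a in WK K | pb (Dmin K (KdJ K J d) a)) Tfin a * Taff d) * vJ J.
Proof.
move=> /Dcos_incr[idJ idK]; rewrite (perm_big _ (dcoset_perm idJ idK)) big_allpairs_dep /=.
rewrite big_enum /= mulr_suml; apply: eq_big => [a|a].
  rewrite inE /pb; case: (boolP (a \in WK K)) => //= aK.
  case: excluded_middle_informative => [/(DminE _ (KdJ_sub K J d))/andP[]//|ne].
  by apply/negbTE/negP => ia; apply: ne; apply/(DminE _ (KdJ_sub K J d)); rewrite aK.
rewrite inE => /andP[aK ia]; rewrite big_enum /= mulr_sumr; apply: eq_bigr => b bJ.
have iad := incr_mul_d idJ idK aK ia.
rewrite !(Tfin_aff q0 sqE relH) -(Taff_mul q0 sqE relH); last exact: alen_mul_incr idK aK.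
by rewrite (Taff_mul q0 sqE relH) // (alen_incr_mul iad).
Qed.

(** For [i] outside [J] the positions [lo i] and [hi i] lie in different blocks, whose order [W_J]
    preserves. *)
Lemma dsc_WK J s i : s \in WK J -> dsc (fW s) (hi i) -> i \in J.
Proof.
move=> sJ ds; apply: contraLR ds => iJ; rewrite dsc_fin !iwinE /= !ffunE !mulr0 !addr0.
rewrite -leNgt lez_nat ltnW // ltnNge; apply/negP => /(@blk_mono _ J).
rewrite !(blk_WK _ (groupVr sJ)) leqNgt => /negP[]; rewrite ltn_neqAle blk_mono /=.
  rewrite andbT; apply/eqP => e; case/negP: iJ; apply: blk_in e _.
  by rewrite /= /bump /=; lia.
by rewrite /bump /=; lia.
Qed.

Lemma Tfin_WK_ind J (P : H -> Prop) :
  P 1 -> (forall i h, i \in J -> P h -> P (T i * h)) -> forall s, s \in WK J -> P (Tfin s).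
Proof.
move=> P1 PT s; move e : (alen (fW s)) => N; elim: N s e => [|N IH] s e sJ.
  by rewrite (alen_fW0 e) (Tfin1 q0 sqE relH).
case: (boolP [exists i : 'I_m.+1, dsc (fW s) (hi i)]) => [/existsP[i di]|/existsPn nd].
  have iJ := dsc_WK sJ di.
  have := alen_saff_down di; rewrite e saff_hi fWM => -[el].
  have nd : ~~ dsc (fW (s * sfin i)%g) (hi i) by rewrite -fWM -saff_hi dsc_saff di.
  have -> : s = ((s * sfin i) * sfin i)%g by rewrite -mulgA sfinK mulg1.
  rewrite -(T_Tfin_up q0 sqE relH) //; apply: PT => //; apply: IH => //.
  by rewrite groupMr ?sfin_WK.
by move: e; rewrite (no_dsc_fW nd) alen1.
Qed.

End ParabolicHecke.

(** * The Bernstein basis and the polynomial representation *)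

Section LaurGen.
Variables (m : nat) (k : fieldType).
Local Notation n := m.+2.
Local Notation L := (Laur m k).

Lemma xv_xvi j : (xv k j : L) * xvi k j = 1.
Proof. by rewrite /xv /xvi LmonM mulr1 subrr. Qed.

Lemma Laur_gen (P : L -> Prop) :
  P 0 -> P 1 -> (forall f g, P f -> P g -> P (f + g)) ->
  (forall f g, P f -> P g -> P (f * g)) -> (forall c f, P f -> P (c *: f)) ->
  (forall j, P (xv k j)) -> (forall j, P (xvi k j)) -> forall f, P f.
Proof.
move=> P0 P1 PD PM PZ PX PXi; apply: Laur_ind => // c l; rewrite LmonZ; apply: PZ.
pose mon (l' : Zn m) : L := << 1 *g l' >>; rewrite -/(mon l).
pose el j z : Zn m := [ffun i : 'I_n => if i == j then z else 0].
have monM l1 l2 : mon l1 * mon l2 = mon (l1 + l2) by rewrite LmonM mulr1.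
have Pz j (z : int) : P (mon (el j z)).
  elim/int_rect: z => [|a IH|a IH].
  - have -> // : mon (el j 0) = 1.
    by congr (<< _ *g _ >>); apply/ffunP => i; rewrite !ffunE if_same.
  - have -> : mon (el j a.+1) = xv k j * mon (el j a).
      rewrite -[xv k j]/(mon (ei j)) monM; congr mon; apply/ffunP => i; rewrite !ffunE.
      by case: eqP => _ //=; lia.
    exact: PM.
  have -> : mon (el j (- a.+1%:Z)) = xvi k j * mon (el j (- a%:Z)).
    rewrite -[xvi k j]/(mon (- ei j)) monM; congr mon; apply/ffunP => i; rewrite !ffunE.
    by case: eqP => _ //=; lia.
  exact: PM.
have -> : mon l = \prod_(j < n) mon (el j (l j)).
  rewrite -(big_morph mon (fun a b => esym (monM a b)) (erefl : mon 0 = 1)).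
  congr mon; apply/ffunP => i; rewrite sum_ffunE (bigD1 i) //=.
  rewrite ffunE eqxx big1 ?addr0 // => j ji.
  by rewrite ffunE eq_sym (negbTE ji).
by elim/big_ind: _ => // j _; apply: Pz.
Qed.

End LaurGen.

Section Bernstein.
Variables (m : nat) (k : fieldType) (q : nat) (H : algType k).
Variables (T : 'I_m.+1 -> H) (X Xi : 'I_m.+2 -> H).
Local Notation n := m.+2.
Local Notation lo i := (widen_ord (leqnSn m.+1) i).
Local Notation hi i := (lift ord0 i).
Local Notation L := (Laur m k).
Hypothesis relH : hecke_rels q T X Xi.

Definition Xz (j : 'I_n) (z : int) : H :=
  match z with Posz a => X j ^+ a | Negz a => Xi j ^+ a.+1 end.
Definition Xm (l : Zn m) : H := \prod_(j < n) Xz j (l j).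
Definition lauH : L -> H := mmap (in_alg H) Xm.

Lemma Xz_S j z : X j * Xz j z = Xz j (z + 1).
Proof.
case: z => [a|a]; first by rewrite -PoszD addn1 /= exprS.
rewrite NegzE; case: a => [|a]; first by rewrite /= (XXi relH).
have -> : - a.+2%:Z + 1 = Negz a by lia.
by rewrite -NegzE /= [Xi j ^+ a.+2]exprS mulrA (XXi relH) mul1r.
Qed.

Lemma Xz_B j z : Xi j * Xz j z = Xz j (z - 1).
Proof. by rewrite -{1}[z](subrK 1) -Xz_S mulrA (XiX relH) mul1r. Qed.

Lemma XzD j z z' : Xz j (z + z') = Xz j z * Xz j z'.
Proof.
elim/int_rect: z z' => [|a IH|a IH] z'; first by rewrite add0r /= mul1r.
  by rewrite -[a.+1]addn1 PoszD -Xz_S -mulrA -IH Xz_S; congr Xz; lia.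
have -> : - a.+1%:Z = - a%:Z - 1 by lia.
by rewrite -Xz_B -mulrA -IH Xz_B; congr Xz; lia.
Qed.

Lemma X_Xi_comm i j : X i * Xi j = Xi j * X i.
Proof.
rewrite -[LHS]mul1r -(XiX relH j) -!mulrA (mulrA (X j)) (X_comm relH) -!mulrA.
by rewrite (XXi relH) mulr1.
Qed.

Lemma Xi_comm i j : Xi i * Xi j = Xi j * Xi i.
Proof.
rewrite -[LHS]mul1r -(XiX relH j) -!mulrA (mulrA (X j)) X_Xi_comm -!mulrA.
by rewrite (XXi relH) mulr1.
Qed.

Lemma Xz_comm i j z z' : GRing.comm (Xz i z) (Xz j z').
Proof.
case: z => a; case: z' => b; rewrite /Xz; apply: commrX; apply: commr_sym; apply: commrX.
- exact: (X_comm relH).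
- by apply: commr_sym; apply: X_Xi_comm.
- exact: X_Xi_comm.
- exact: Xi_comm.
Qed.

Lemma XmD l l' : Xm (l + l') = Xm l * Xm l'.
Proof.
rewrite /Xm -prodrM_comm; last by move=> i j _ _; apply: Xz_comm.
by apply: eq_bigr => j _; rewrite ffunE XzD.
Qed.

Lemma lauHM (f g : L) : lauH (f * g) = lauH f * lauH g.
Proof.
rewrite -LmulE; apply: mmap_Lmul => [|c l]; first exact: XmD.
by rewrite /GRing.comm /= mulr_algl mulr_algr.
Qed.

Lemma lauHD (f g : L) : lauH (f + g) = lauH f + lauH g.
Proof. exact: raddfD. Qed.

Lemma lauH0 : lauH 0 = 0.
Proof. exact: raddf0. Qed.

Lemma lauHU c l : lauH << c *g l >> = c *: Xm l.
Proof. by rewrite /lauH mmapU /= mulr_algl. Qed.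

Lemma Xm0 : Xm 0 = 1.
Proof. by rewrite /Xm big1 // => j _; rewrite ffunE. Qed.

Lemma lauH1 : lauH 1 = 1.
Proof. by rewrite lauHU Xm0 scale1r. Qed.

Lemma lauHZ c f : lauH (c *: f) = c *: lauH f.
Proof.
rewrite -[c *: f]mulr_algl lauHM -[c%:A]LmonZ lauHU Xm0 -scalerAl mul1r //.
Qed.

Lemma Xm_ei j : Xm (ei j) = X j.
Proof.
by rewrite /Xm (big_only1 j) ?ffunE ?eqxx //= => i ij _; rewrite ffunE (negbTE ij).
Qed.

Lemma lauH_xv j : lauH (xv k j) = X j.
Proof. by rewrite lauHU scale1r Xm_ei. Qed.

Lemma lauH_xvi j : lauH (xvi k j) = Xi j.
Proof.
have : X j * lauH (xvi k j) = 1 by rewrite -lauH_xv -lauHM xv_xvi lauH1.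
by move/(congr1 (fun x => Xi j * x)); rewrite mulrA (XiX relH) mul1r mulr1.
Qed.

Lemma permv_ei (s : {perm 'I_n}) j : permv s (ei j) = ei (s j).
Proof.
apply/ffunP => i; rewrite permvE !ffunE; congr (nat_of_bool _)%:Z.
by apply/eqP/eqP => [<-|->]; rewrite ?permKV ?permK.
Qed.

Lemma permL_xv s j : permL s (xv k j) = xv k (s j) :> L.
Proof. by rewrite permLU permv_ei. Qed.

Lemma permL_xvi s j : permL s (xvi k j) = xvi k (s j) :> L.
Proof. by rewrite permLU permvN permv_ei. Qed.

Hypothesis q0 : (q%:R : k) != 0.

Lemma bernstein_X i j : exists g : L, T i * X j = X (sfin i j) * T i + lauH g.
Proof.
have [->|jlo] := eqVneq j (lo i).
  exists ((1 - q%:R) *: xv k (hi i)); rewrite (TX_Tinv q0 relH) TinvE sfin_lo.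
  rewrite lauHZ lauH_xv -scalerAr scalerA mulfV // scale1r mulrBr -scalerAr mulr1.
  by rewrite -scaleNr opprB.
have [->|jhi] := eqVneq j (hi i).
  exists ((q%:R - 1) *: xv k (hi i)); rewrite sfin_hi lauHZ lauH_xv.
  have -> : X (hi i) = (q%:R : k)^-1 *: (T i * X (lo i) * T i).
    by rewrite (TXT relH) scalerA mulVf // scale1r.
  rewrite -scalerAr !mulrA (T_quad relH) !mulrDl -!scalerAl mul1r scalerDr !scalerA mulVf //.
  by rewrite scale1r addrC mulrC.
by exists 0; rewrite lauH0 addr0 (TX_comm relH) // /sfin tpermD // eq_sym.
Qed.

(* Only the existence of the correction term [g] is needed, not its formula. *)
Lemma bernstein i (f : L) :
  exists g, T i * lauH f = lauH (permL (sfin i) f) * T i + lauH g.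
Proof.
elim/Laur_gen: f => [||f1 f2 [g1 E1] [g2 E2]|f1 f2 [g1 E1] [g2 E2]|c f [g E]|j|j].
- by exists 0; rewrite rmorph0 !lauH0 mulr0 mul0r addr0.
- by exists 0; rewrite rmorph1 !lauH1 lauH0 mulr1 mul1r addr0.
- by exists (g1 + g2); rewrite rmorphD /= !lauHD mulrDr mulrDl E1 E2 addrACA.
- exists (permL (sfin i) f1 * g2 + g1 * f2).
  by rewrite rmorphM /= lauHD !lauHM mulrA E1 mulrDl -mulrA E2 mulrDr !mulrA addrA.
- by exists (c *: g); rewrite permLZ !lauHZ -scalerAr E scalerDr -scalerAl.
- by rewrite permL_xv !lauH_xv; apply: bernstein_X.
rewrite permL_xvi !lauH_xvi; have [g E] := bernstein_X i j; set j' := sfin i j in E *.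
exists (- (xvi k j' * g * xvi k j)).
rewrite [lauH (- _)]raddfN /= -/lauH !lauHM !lauH_xvi.
have -> : T i * Xi j = Xi j' * (X j' * T i) * Xi j.
  by rewrite (mulrA (Xi j')) (XiX relH) mul1r.
have -> : X j' * T i = T i * X j - lauH g by rewrite E addrK.
by rewrite mulrBr mulrBl -!mulrA (XXi relH) mulr1.
Qed.


End Bernstein.

Lemma fun_choice (A B : Type) (R : A -> B -> Prop) :
  (forall x, exists y, R x y) -> exists f, forall x, R x (f x).
Proof.
move=> h; exists (fun x => sval (constructive_indefinite_description _ (h x))) => x.
exact: svalP.
Qed.

(** * Bernstein basis, faithfulness, and left annihilators of v_J *)

Section PolynomialRepresentation.
Variables (m : nat) (k : fieldType) (q : nat) (sq : k) (H : algType k).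
Variables (T : 'I_m.+1 -> H) (X Xi : 'I_m.+2 -> H).
Variable pi : H -> Laur m k -> Laur m k.
Local Notation n := m.+2.
Local Notation lo i := (widen_ord (leqnSn m.+1) i).
Local Notation hi i := (lift ord0 i).
Local Notation L := (Laur m k).
Hypotheses (q0 : (q%:R : k) != 0) (sqE : sq ^+ 2 = q%:R).
Hypothesis relH : hecke_rels q T X Xi.
Hypothesis genH : hecke_generated T X Xi.
Hypothesis repH : polyrep q T X Xi pi.
Local Notation Tfin := (Tfin T).
Local Notation vJ := (vJ T).
Local Notation lauH := (@lauH m k H X Xi).
Implicit Types (s t b : {perm 'I_n}) (K J : {set 'I_m.+1}) (f g : L) (h u v : H).

Definition comb (c : {perm 'I_n} -> L) : H := \sum_s lauH (c s) * Tfin s.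

Lemma combD c c' : comb (fun s => c s + c' s) = comb c + comb c'.
Proof.
by rewrite /comb -big_split; apply: eq_bigr => s _; rewrite /= (lauHD X Xi) mulrDl.
Qed.

Lemma combM f c : comb (fun s => f * c s) = lauH f * comb c.
Proof.
by rewrite /comb mulr_sumr; apply: eq_bigr => s _; rewrite (lauHM relH) mulrA.
Qed.

Lemma combZ a c : comb (fun s => a *: c s) = a *: comb c.
Proof.
by rewrite /comb scaler_sumr; apply: eq_bigr => s _; rewrite (lauHZ relH) scalerAl.
Qed.

Lemma comb_delta f s : comb (fun t => if t == s then f else 0) = lauH f * Tfin s.
Proof.
rewrite /comb (bigD1 s) //= eqxx big1 ?addr0 // => t /negbTE->.
by rewrite (lauH0 X Xi) mul0r.
Qed.

Definition spanned h := exists c, h = comb c.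

Lemma spannedD h h' : spanned h -> spanned h' -> spanned (h + h').
Proof. by move=> [c ->] [c' ->]; eexists; rewrite -combD. Qed.

Lemma spanned_sum (I : Type) (r : seq I) (P : pred I) (F : I -> H) :
  (forall i, P i -> spanned (F i)) -> spanned (\sum_(i <- r | P i) F i).
Proof.
move=> hF; elim/big_ind: _ => //; last exact: spannedD.
by exists (fun=> 0); rewrite /comb big1 // => s _; rewrite (lauH0 X Xi) mul0r.
Qed.

Lemma spanned_lauH f h : spanned h -> spanned (lauH f * h).
Proof. by move=> [c ->]; eexists; rewrite -combM. Qed.

Lemma spannedZ a h : spanned h -> spanned (a *: h).
Proof. by move=> [c ->]; eexists; rewrite -combZ. Qed.

Lemma spanned_Tfin s : spanned (Tfin s).
Proof. by rewrite -[Tfin s]mul1r -(lauH1 X Xi) -comb_delta; eexists. Qed.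

Lemma spanned_all h : spanned h.
Proof.
(* Induction over generated elements must pass through products, so the claim is strengthened to
   stability of the span under left multiplication by [h]. *)
suff : forall y, spanned y -> spanned (h * y).
  by move/(_ 1); rewrite mulr1; apply; rewrite -(Tfin1 q0 sqE relH); apply: spanned_Tfin.
apply: (genH (P := fun h => forall y, spanned y -> spanned (h * y))).
- by move=> y; rewrite mul1r.
- move=> i _ [c ->]; rewrite /comb mulr_sumr; apply: spanned_sum => s _.
  have [g E] := bernstein relH q0 i (c s); rewrite mulrA E mulrDl -mulrA.
  apply: spannedD; apply: spanned_lauH; last exact: spanned_Tfin.
  have [ds|nd] := boolP (dsc (fW s) (hi i)); last first.
    by rewrite (T_Tfin_up q0 sqE relH) //; apply: spanned_Tfin.
  rewrite (T_Tfin_down q0 sqE relH) //.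
  by apply: spannedD; apply: spannedZ; apply: spanned_Tfin.
- by move=> j y; rewrite -(lauH_xv X Xi); apply: spanned_lauH.
- by move=> j y; rewrite -(lauH_xvi relH); apply: spanned_lauH.
- move=> a x y Px Py z Pz; rewrite mulrDl -scalerAl.
  by apply: spannedD; [apply/spannedZ/Px|apply: Py].
- by move=> x y Px Py z Pz; rewrite -mulrA; apply/Px/Py.
Qed.

Lemma piL a u v f : pi (a *: u + v) f = a *: pi u f + pi v f.
Proof. by case: repH => h _; apply: h. Qed.
Lemma piM u v f : pi (u * v) f = pi u (pi v f).
Proof. by case: repH => _ [h _]; apply: h. Qed.
Lemma pi1 f : pi 1 f = f.
Proof. by case: repH => _ [_ [h _]]; apply: h. Qed.
Lemma piR u a f g : pi u (a *: f + g) = a *: pi u f + pi u g.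
Proof. by case: repH => _ [_ [_ [h _]]]; apply: h. Qed.
Lemma piX j f : pi (X j) f = xv k j * f.
Proof. by case: repH => _ [_ [_ [_ [h _]]]]; apply: h. Qed.
Lemma piXi j f : pi (Xi j) f = xvi k j * f.
Proof. by case: repH => _ [_ [_ [_ [_ [h _]]]]]; apply: h. Qed.

(** After clearing denominators [T i] acts as [(alp i + bet i s_i) / dlt i] ([piT]); [alp i] is
    [(1 - q) xv (hi i)]. *)
Definition dlt i : L := xv k (lo i) - xv k (hi i).
Definition bet i : L := (q%:R : k) *: xv k (lo i) - xv k (hi i).
Definition alp i : L := (q%:R : k) *: dlt i - bet i.

Lemma piT i f : dlt i * pi (T i) f = alp i * f + bet i * permL (sfin i) f.
Proof.
case: repH => _ [_ [_ [_ [_ [_ h]]]]]; have := h i f; rewrite !LmulE -/(dlt i) -/(bet i) => ->.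
rewrite /alp; move: (dlt i) (bet i) => d b.
by rewrite mulrBr mulrBl -scalerAr -scalerAl opprB addrA addrAC.
Qed.

Lemma piD u v f : pi (u + v) f = pi u f + pi v f.
Proof. by have := piL 1 u v f; rewrite !scale1r. Qed.
Lemma pi0 f : pi 0 f = 0.
Proof. by apply: (@addrI _ (pi 0 f)); rewrite -piD !addr0. Qed.
Lemma piZ a u f : pi (a *: u) f = a *: pi u f.
Proof. by have := piL a u 0 f; rewrite !addr0 pi0 addr0. Qed.
Lemma piB u v f : pi (u - v) f = pi u f - pi v f.
Proof. by rewrite piD -scaleN1r piZ scaleN1r. Qed.
Lemma pi_sum (I : Type) (r : seq I) (P : pred I) (F : I -> H) f :
  pi (\sum_(i <- r | P i) F i) f = \sum_(i <- r | P i) pi (F i) f.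
Proof.
exact: (big_morph (fun u => pi u f) (fun u v => piD u v f) (pi0 f)).
Qed.
Lemma piDr u f g : pi u (f + g) = pi u f + pi u g.
Proof. by have := piR u 1 f g; rewrite !scale1r. Qed.
Lemma pi0r u : pi u 0 = 0.
Proof. by apply: (@addrI _ (pi u 0)); rewrite -piDr !addr0. Qed.

Lemma pi_lauH f g : pi (lauH f) g = f * g.
Proof.
elim/Laur_gen: f g => [||f1 f2 E1 E2|f1 f2 E1 E2|c f E|j|j] g.
- by rewrite (lauH0 X Xi) pi0 mul0r.
- by rewrite (lauH1 X Xi) pi1 mul1r.
- by rewrite (lauHD X Xi) piD E1 E2 mulrDl.
- by rewrite (lauHM relH) piM E2 E1 mulrA.
- by rewrite (lauHZ relH) piZ E scalerAl.
- by rewrite (lauH_xv X Xi) piX.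
- by rewrite (lauH_xvi relH) piXi.
Qed.

Lemma coef_xv_neq (i j : 'I_n) : i != j -> (xv k i)@_(ei j) = 0.
Proof.
move=> ij; rewrite mcoeffU; case: eqP => // /ffunP/(_ j); rewrite !ffunE eqxx eq_sym.
by rewrite (negbTE ij).
Qed.

Lemma dlt_neq0 i : dlt i != 0.
Proof.
apply/eqP => /malgP/(_ (ei (hi i)))/eqP.
by rewrite mcoeffB coef_xv_neq ?lo_neq_hi // mcoeffUU mcoeff0 sub0r oppr_eq0 oner_eq0.
Qed.

Lemma bet_neq0 i : bet i != 0.
Proof.
apply/eqP => /malgP/(_ (ei (hi i)))/eqP.
rewrite mcoeffB mcoeffZ coef_xv_neq ?lo_neq_hi // mcoeffUU mcoeff0 mulr0 sub0r.
by rewrite oppr_eq0 oner_eq0.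
Qed.

(** Along a reduced word, the operators [(alp + bet s_i) / dlt] multiply to a combination of
    permutations. The term [s] arises only by taking every [s_i], with the nonzero factors [bet];
    all other terms are shorter. [D] is a common denominator. *)
Lemma Tfin_triangular s : exists (D : L) (c : {perm 'I_n} -> L),
  [/\ D != 0, c s != 0,
      forall f, D * pi (Tfin s) f = \sum_t c t * permL t f
    & forall t, c t != 0 -> t = s \/ (alen (fW t) < alen (fW s))%N].
Proof.
move e : (alen (fW s)) => N; elim: N s e => [|N IH] s e.
  exists 1, (fun t => if t == 1%g then 1 else 0).
  rewrite (alen_fW0 e) (Tfin1 q0 sqE relH) eqxx; split; rewrite ?oner_eq0 //.
    move=> f; rewrite (bigD1 1%g) //= eqxx pi1 permL1 big1 ?addr0 // => t /negbTE->.
    by rewrite mul0r.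
  by move=> t; case: (t =P 1%g) => [->|_]; [left|rewrite eqxx].
have [i di] : exists i : 'I_m.+1, dsc (fW s) (hi i).
  apply/existsP; apply: contraT => /existsPn/no_dsc_fW es.
  by move: e; rewrite es alen1.
have := alen_saff_down di; rewrite e saff_hi fWM => -[/esym e'].
have [D [c [D0 cs hc tri]]] := IH _ e'; set s' := (s * sfin i)%g in e' cs hc tri *.
have es : s = (s' * sfin i)%g by rewrite /s' -mulgA sfinK mulg1.
have nd : ~~ dsc (fW s') (hi i) by rewrite -fWM -saff_hi dsc_saff di.
(* [s] is longer than [s'], so the [alp] term contributes nothing to the leading coefficient. *)
have c0 : c s = 0.
  apply/eqP; apply: contraT => /tri[ss'|]; last by rewrite e ltnNge leqnSn.
  by move: e; rewrite ss' e' => /n_Sn.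
pose c1 t := alp i * permL (sfin i) D * c t + bet i * D * permL (sfin i) (c (t * sfin i)%g).
(* The factor [permL (sfin i) D] is needed because [T i] applies [s_i] to the denominator of the
   inner expression. *)
exists (D * permL (sfin i) D * dlt i), c1; split.
- by rewrite !Lmul_eq0 !negb_or D0 permL_eq0 D0 dlt_neq0.
- rewrite /c1 c0 mulr0 add0r -/s' !Lmul_eq0 !negb_or bet_neq0 D0 /=.
  by rewrite permL_eq0.
- move=> f; rewrite {1}es -(T_Tfin_up q0 sqE relH) // piM -mulrA piT mulrDr.
  have -> : D * permL (sfin i) D * (alp i * pi (Tfin s') f)
            = alp i * permL (sfin i) D * (D * pi (Tfin s') f).
    move: (permL (sfin i) D) (alp i) (pi (Tfin s') f) => x y z.
    by rewrite mulrACA [RHS]mulrCA -!mulrA; congr (_ * _); rewrite mulrCA.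
  have -> : D * permL (sfin i) D * (bet i * permL (sfin i) (pi (Tfin s') f))
            = bet i * D * permL (sfin i) (D * pi (Tfin s') f).
    by rewrite rmorphM /= mulrCA !mulrA.
  rewrite hc rmorph_sum /= /c1; move: (alp i * permL (sfin i) D) (bet i * D) => a b.
  rewrite [X in X + _]mulr_sumr [X in _ + X]mulr_sumr.
  rewrite [X in _ + X](reindex_inj (mulIg (sfin i))) /= -big_split; apply: eq_bigr => t _ /=.
  by rewrite rmorphM /= -permLM -mulgA sfinK mulg1 mulrDl !mulrA.
move=> t; have [ct|ct] := eqVneq (c t) 0; last first.
  move=> _; right; case: (tri _ ct) => [->|lt]; first by rewrite e'.
  by rewrite ltnS ltnW.
rewrite /c1 ct mulr0 add0r !Lmul_eq0 !negb_or permL_eq0 => /andP[_ /tri[ets|lt]].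
  by left; rewrite es -ets -mulgA sfinK mulg1.
right; have := alen_saff_le (fW (t * sfin i)%g) (hi i).
rewrite saff_hi fWM -mulgA sfinK mulg1 => le.
by rewrite ltnS (leq_trans le).
Qed.

(** Clearing all denominators gives a relation among permutations, to which [permL_indep] applies.
    At a longest [s1] in the support of [c], only the leading term of [Tfin s1] contributes. *)
Lemma comb_faithful c : (forall f, pi (comb c) f = 0) -> forall s, c s = 0.
Proof.
move=> h; have [D hD] := fun_choice Tfin_triangular; have [e E] := fun_choice hD.
pose Dh s := \prod_(t | t != s) D t.
have Dh0 s : Dh s != 0 by apply: Lprod_neq0 => t _; case: (E t).
have rel t : \sum_s c s * Dh s * e s t = 0.
  apply: (permL_indep (c := fun t => \sum_s c s * Dh s * e s t)) => f.
  transitivity ((\prod_s D s) * pi (comb c) f); last by rewrite h mulr0.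
  rewrite /comb pi_sum mulr_sumr.
  under [LHS]eq_bigr => t' _ do rewrite mulr_suml.
  rewrite exchange_big; apply: eq_bigr => s _ /=.
  have [_ _ Es _] := E s.
  rewrite piM pi_lauH [X in _ = X * _](bigD1 s) //= -/(Dh s).
  have -> : D s * Dh s * (c s * pi (Tfin s) f) = c s * Dh s * (D s * pi (Tfin s) f).
    move: (D s) (Dh s) (c s) (pi (Tfin s) f) => x y z w.
    by rewrite mulrACA [RHS]mulrACA (mulrC x z).
  by rewrite Es mulr_sumr; apply: eq_bigr => t' _; rewrite mulrA.
move=> s; apply/eqP; apply: contraT => cs0.
have [s1 c1 max] := @arg_maxnP _ s (fun t => c t != 0) (fun t => alen (fW t)) cs0.
have := rel s1; rewrite (bigD1 s1) //= big1 ?addr0.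
  move/eqP; rewrite !Lmul_eq0 (negbTE c1) (negbTE (Dh0 _)) /=.
  by have [_ /negbTE-> _ _] := E s1.
move=> t ts1; have [->|ct] := eqVneq (c t) 0; first by rewrite !mul0r.
have [_ _ _ tri] := E t; have [->|es] := eqVneq (e t s1) 0; first by rewrite mulr0.
case: (tri _ es) => [st|]; first by rewrite st eqxx in ts1.
by rewrite ltnNge => /negP[]; apply: max.
Qed.

Lemma pi_faithful h : (forall f, pi h f = 0) -> h = 0.
Proof.
have [c ->] := spanned_all h => /comb_faithful c0; rewrite /comb big1 // => s _.
by rewrite c0 (lauH0 X Xi) mul0r.
Qed.

Lemma comb_inj c c' : comb c = comb c' -> forall s, c s = c' s.
Proof.
move=> e s; apply/eqP; rewrite -subr_eq0; apply/eqP; move: s.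
apply: comb_faithful => f; rewrite combD e.
have -> : comb (fun s => - c' s) = - comb c'.
  by rewrite -scaleN1r -combZ; apply: eq_bigr => s _; rewrite scaleN1r.
by rewrite subrr pi0.
Qed.

(** If [t] is shorter than [t s_i], then [T_t] occurs in [h T_i] only through [T_{t s_i} T_i], with
    coefficient [q c(t s_i)]. Comparison with [q c(t)] makes [c] constant on the cosets [t W_J], so
    each coset contributes a multiple of [vJ J]. *)
Lemma eigen_vJ J h : (forall i, i \in J -> h * T i = (q%:R : k) *: h) ->
  exists h', h = h' * vJ J.
Proof.
have [c ->] := spanned_all h => hT.
have cT i s : i \in J -> c (sfin i * s)%g = c s.
  have key t : i \in J -> ~~ dsc (fW (t^-1)%g) (hi i) -> c (sfin i * t)%g = c t.
    move=> iJ nd.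
    pose c1 t := if dsc (fW (t^-1)%g) (hi i) then c (sfin i * t)%g + (q%:R - 1 : k) *: c t
                 else (q%:R : k) *: c (sfin i * t)%g.
    have E : comb c * T i = comb c1.
      rewrite /comb mulr_suml (bigID (fun t => dsc (fW (t^-1)%g) (hi i))) /=.
      rewrite [RHS](bigID (fun t => dsc (fW (t^-1)%g) (hi i))) /=.
      have dn w : dsc (fW ((sfin i * w)^-1)%g) (hi i) = ~~ dsc (fW (w^-1)%g) (hi i).
        by rewrite invMg sfinV -fWM -saff_hi dsc_saff.
      under eq_bigr => w dw do rewrite -mulrA (Tfin_T_down q0 sqE relH dw) mulrDr -!scalerAr.
      rewrite big_split /= addrC addrA; congr (_ + _).
        rewrite (reindex_inj (mulgI (sfin i))) /=.
        rewrite (eq_bigl (fun w => dsc (fW (w^-1)%g) (hi i))); last by move=> w; rewrite dn negbK.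
        rewrite -big_split; apply: eq_bigr => w dw /=; rewrite /c1 dw (lauHD X Xi) mulrDl.
        rewrite (lauHZ relH) -scalerAl -mulrA (Tfin_T_up q0 sqE relH) ?dn ?dw //.
        by rewrite mulgA sfinK mul1g.
      rewrite (reindex_inj (mulgI (sfin i))) /=; apply: eq_big => [w|w]; first by rewrite dn.
      rewrite dn => dw; rewrite /c1 (negbTE dw) (lauHZ relH) -scalerAl mulgA sfinK mul1g //.
    have := comb_inj (etrans (esym E) (etrans (hT i iJ) (esym (combZ _ _)))) t.
    rewrite /c1 (negbTE nd) => /(congr1 (fun x => (q%:R : k)^-1 *: x)).
    by rewrite !scalerA mulVf // !scale1r.
  move=> iJ; have [ds|nd] := boolP (dsc (fW (s^-1)%g) (hi i)); last exact: key.
  rewrite -[in RHS](mul1g s) -(sfinK i) -mulgA [in RHS]key //.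
  by rewrite invMg sfinV -fWM -saff_hi dsc_saff ds.
have cW b s : b \in WK J -> c (b * s)%g = c s.
  pose G0 := [set b : {perm 'I_n} | [forall s, c (b * s)%g == c s]].
  have gG0 : group_set G0.
    apply/group_setP; split=> [|u v]; first by rewrite inE; apply/forallP => w; rewrite mul1g.
    rewrite !inE => /forallP hu /forallP hv; apply/forallP => w.
    by rewrite -mulgA (eqP (hu _)) (eqP (hv _)).
  have sub : WK J \subset G0.
    rewrite -[G0]/(gval (Group gG0)) gen_subG; apply/subsetP => _ /imsetP[i iJ ->].
    by rewrite inE; apply/forallP => w; rewrite cT.
  by move=> /(subsetP sub); rewrite inE => /forallP/(_ s)/eqP.
exists (\sum_(s | incr J (fW s)) lauH (c s) * Tfin s).
rewrite /comb (sum_coset J) mulr_suml; apply: eq_bigr => s iJs.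
rewrite -mulrA mulr_sumr mulr_sumr; apply: eq_bigr => b bJ.
by rewrite cW // (Tfin_mul q0 sqE relH iJs).
Qed.

Lemma vJ_neq0 J : vJ J != 0.
Proof.
apply/eqP => e; have E : vJ J = comb (fun s => if s \in WK J then 1 else 0).
  rewrite /Defs.vJ big_mkcond; apply: eq_bigr => s _.
  by case: ifP => _; rewrite ?(lauH1 X Xi) ?(lauH0 X Xi) ?mul1r ?mul0r.
have := comb_faithful (c := fun s => if s \in WK J then 1 else 0) _ 1%g.
rewrite group1 -E e => /(_ pi0)/eqP; by rewrite oner_eq0.
Qed.

Lemma vJ_act_neq0 J : exists g, pi (vJ J) g != 0.
Proof.
apply: NNPP => ne; case/eqP: (vJ_neq0 J); apply: pi_faithful => f.
by apply/eqP; apply: contraT => fz; case: ne; exists f.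
Qed.

(** By [piT] the eigenvalue equation says [bet i * permL (sfin i) f = bet i * f], and [bet i] can be
    cancelled. *)
Lemma T_inv K f : (forall i, i \in K -> pi (T i) f = (q%:R : k) *: f) -> Defs.invariant K f.
Proof.
move=> hT; have hs i : i \in K -> permL (sfin i) f = f.
  move=> iK; apply: (LmulI (bet_neq0 i)); apply: (@addrI _ (alp i * f)).
  by rewrite -piT hT // -mulrDl /alp subrK -scalerAl scalerAr.
pose G0 := [set s : {perm 'I_n} | permL s f == f].
have gG0 : group_set G0.
  apply/group_setP; split=> [|u v]; first by rewrite inE permL1.
  by rewrite !inE permLM => /eqP-> /eqP->.
have sub : WK K \subset G0.
  rewrite -[G0]/(gval (Group gG0)) gen_subG; apply/subsetP => _ /imsetP[i iK ->].
  by rewrite inE hs.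
by move=> s /(subsetP sub); rewrite inE => /eqP.
Qed.

Lemma vJ_inv J g : Defs.invariant J (pi (vJ J) g).
Proof.
by apply: T_inv => i iJ; rewrite -piM (T_vJ q0 sqE relH iJ) piZ.
Qed.

Lemma piT_mul i f g : permL (sfin i) f = f -> pi (T i) (f * g) = f * pi (T i) g.
Proof.
move=> hf; apply: (LmulI (dlt_neq0 i)).
rewrite piT rmorphM /= hf; have := piT i g; move: (pi (T i) g) (permL (sfin i) g) => x y.
move: (alp i) (bet i) (dlt i) => a b c E.
by rewrite (mulrCA a f g) (mulrCA b f y) (mulrCA c f x) E mulrDr.
Qed.

Lemma pi_sym_mul h f g : (forall s, permL s f = f) -> pi h (f * g) = f * pi h g.
Proof.
move=> fs; move: g; apply: (genH (P := fun h => forall g, pi h (f * g) = f * pi h g)) h.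
- by move=> g; rewrite !pi1.
- by move=> i g; apply: piT_mul.
- by move=> j g; rewrite !piX mulrCA.
- by move=> j g; rewrite !piXi mulrCA.
- by move=> a x y Px Py g; rewrite !piL Px Py mulrDr scalerAr.
- by move=> x y Px Py g; rewrite !piM Py Px.
Qed.

Lemma pi_vJ_mul J f g : Defs.invariant J f -> pi (vJ J) (f * g) = f * pi (vJ J) g.
Proof.
move=> fJ; rewrite /Defs.vJ !pi_sum mulr_sumr; apply: eq_bigr => s sJ.
move: s sJ; apply: (Tfin_WK_ind q0 sqE relH (P := fun h => pi h (f * g) = f * pi h g)).
  by rewrite !pi1.
by move=> i x iJ Px; rewrite !piM Px piT_mul // fJ ?sfin_WK.
Qed.

(* A nonzero [z] in the image of [vJ] divides its symmetric norm [N]; so      *)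
(* [N f] is in the image of [vJ], while [N] commutes with the action of [H].  *)
Lemma ann_vJ J h f : h * vJ J = 0 -> Defs.invariant J f -> pi h f = 0.
Proof.
move=> hv fJ; have [g z0] := vJ_act_neq0 J; set z := pi (vJ J) g in z0.
pose M : L := \prod_(s : {perm 'I_n} | s != 1%g) permL s z.
have Nsym s : permL s (z * M) = z * M.
  have -> : z * M = \prod_s permL s z by rewrite [RHS](bigD1 1%g) //= permL1.
  rewrite rmorph_prod [RHS](reindex_inj (mulIg s)) /=; apply: eq_bigr => t _.
  by rewrite permLM.
have N0 : z * M != 0.
  by rewrite Lmul_eq0 negb_or z0 Lprod_neq0 // => s _; rewrite permL_eq0.
have MJ : Defs.invariant J M.
  move=> s sJ; apply: (LmulI z0).
  have zs : permL s z = z by apply: vJ_inv sJ.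
  by rewrite -[RHS](Nsym s) rmorphM /= zs.
have MfJ : Defs.invariant J (M * f) by move=> s sJ; rewrite rmorphM /= MJ // fJ.
apply: (LmulI N0); rewrite mulr0 -pi_sym_mul // -mulrA mulrC -pi_vJ_mul //.
by rewrite -piM hv pi0.
Qed.

End PolynomialRepresentation.

(** * The action of the Schur algebra *)

Section SchurAction.
Variables (m : nat) (k : fieldType) (q : nat) (sq : k) (H : algType k).
Variables (T : 'I_m.+1 -> H) (X Xi : 'I_m.+2 -> H).
Variable pi : H -> Laur m k -> Laur m k.
Local Notation n := m.+2.
Local Notation L := (Laur m k).
Hypotheses (q0 : (q%:R : k) != 0) (sqE : sq ^+ 2 = q%:R).
Hypothesis relH : hecke_rels q T X Xi.
Hypothesis genH : hecke_generated T X Xi.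
Hypothesis repH : polyrep q T X Xi pi.
Local Notation vJ := (vJ T).
Implicit Types (K J : {set 'I_m.+1}) (phi psi : Fam m H -> Fam m H).

Definition entry phi K J : H := phi (eJ J (vJ J)) K.

(** A chosen solution of [h = h' * vJ J], an unspecified value when there is none. Solutions need
    not be unique; [schur_actE] shows that the choice does not affect the action. *)
Definition left_factor J (h : H) : H := epsilon (inhabits 0) (fun h' => h = h' * vJ J).

Lemma left_factorP J h : (exists h', h = h' * vJ J) -> h = left_factor J h * vJ J.
Proof. exact: (epsilon_spec (inhabits 0) (fun h' => h = h' * vJ J)). Qed.

Definition schur_act phi (P : PF m k) : PF m k :=
  fun K => \sum_J pi (left_factor J (entry phi K J)) (P J).

Lemma inM_eJ J h : inM T (eJ J (vJ J * h)).
Proof.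
move=> J'; rewrite /eJ; case: eqP => [->|_]; first by exists h.
by exists 0; rewrite mulr0.
Qed.

Lemma inM_eJ1 J : inM T (eJ J (vJ J)).
Proof. by rewrite -[vJ J]mulr1; apply: inM_eJ. Qed.

Lemma eJ_mulr J (u h : H) : eJ J (u * h) = (fun J' => eJ J u J' * h).
Proof.
by apply: functional_extensionality => J'; rewrite /eJ; case: eqP => _; rewrite ?mul0r.
Qed.

Lemma isS_eJ phi J h K : isS T phi -> phi (eJ J (vJ J * h)) K = entry phi K J * h.
Proof. by move=> [_ _ hR]; rewrite eJ_mulr hR //; apply: inM_eJ1. Qed.

Lemma isS_sum phi x K : isS T phi -> inM T x -> phi x K = \sum_J phi (eJ J (x J)) K.
Proof.
move=> [hM hD hR] xM.
have phi0 : phi (fun=> 0) = fun=> 0.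
  have /(_ _ 0 xM) := hR.
  have -> : (fun J => x J * 0) = (fun=> 0).
    by apply: functional_extensionality => J; rewrite mulr0.
  by move=> ->; apply: functional_extensionality => J; rewrite mulr0.
have eM J : inM T (eJ J (x J)) by have [h ->] := xM J; apply: inM_eJ.
(* Additivity of [phi] concerns two summands, so the family is built up one index at a time. *)
pose part (r : seq {set 'I_m.+1}) : Fam m H := fun J => if J \in r then x J else 0.
have partM r : inM T (part r).
  by move=> J; rewrite /part; case: ifP => _; [apply: xM|exists 0; rewrite mulr0].
have step r : uniq r -> phi (part r) K = \sum_(J <- r) phi (eJ J (x J)) K.
  elim: r => [|J r IH] /=; first by rewrite big_nil /part phi0.
  move=> /andP[Jr ur]; rewrite big_cons -IH //.
  have -> : part (J :: r) = (fun J' => eJ J (x J) J' + part r J').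
    apply: functional_extensionality => J'; rewrite /part /eJ inE.
    case: (J' =P J) => [->|_] /=; first by rewrite (negbTE Jr) addr0.
    by rewrite add0r.
  by rewrite hD.
have <- : part (enum {set 'I_m.+1}) = x.
  by apply: functional_extensionality => J; rewrite /part mem_enum.
rewrite step ?enum_uniq // big_enum; apply: eq_bigr => J _.
by rewrite /part mem_enum.
Qed.

Lemma isS_entry phi x K : isS T phi -> inM T x ->
  forall y, (forall J, x J = vJ J * y J) -> phi x K = \sum_J entry phi K J * y J.
Proof.
move=> pS xM y xy; rewrite isS_sum //; apply: eq_bigr => J _.
by rewrite xy isS_eJ.
Qed.

(** Since [vJ J * T i] is [q] times [vJ J], right linearity makes the entry an eigenvector for right
    multiplication by [T i], as [eigen_vJ] requires. *)
Lemma entry_factor phi K J : isS T phi ->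
  entry phi K J = left_factor J (entry phi K J) * vJ J.
Proof.
move=> pS; apply: left_factorP; apply: (eigen_vJ q0 sqE relH genH repH) => i iJ.
rewrite -isS_eJ // (vJ_T q0 sqE relH iJ) -[_ *: vJ J]mulr_algr isS_eJ //.
by rewrite mulr_algr.
Qed.

Lemma schur_actE phi (c : {set 'I_m.+1} -> {set 'I_m.+1} -> H) P :
  (forall K J, entry phi K J = c K J * vJ J) -> inP P ->
  schur_act phi P = fun K => \sum_J pi (c K J) (P J).
Proof.
move=> hc PP; apply: functional_extensionality => K; apply: eq_bigr => J _.
have e : entry phi K J = left_factor J (entry phi K J) * vJ J.
  by apply: left_factorP; exists (c K J).
apply/eqP; rewrite -subr_eq0 -(piB repH); apply/eqP.
apply: (ann_vJ q0 sqE relH genH repH (J := J)); last exact: PP.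
by rewrite mulrBl -e hc subrr.
Qed.

Lemma T_entry phi K J i : isS T phi -> i \in K -> T i * entry phi K J = (q%:R : k) *: entry phi K J.
Proof.
move=> [hM _ _] iK; have [h eh] := hM _ (inM_eJ1 J) K.
by rewrite /entry eh mulrA (T_vJ q0 sqE relH iK) scalerAl.
Qed.

(** With [h'] the left factor, [T i * h' - q h'] annihilates [vJ J] by [T_entry]. Hence [ann_vJ]
    gives the eigenvalue equation on [P J], and [T_inv] turns it into invariance. *)
Lemma schur_act_inv phi P : isS T phi -> inP P -> inP (schur_act phi P).
Proof.
move=> pS PP K; apply: (T_inv repH) => i iK; rewrite /schur_act.
rewrite (big_morph (pi (T i)) (piDr repH (T i)) (pi0r repH (T i))) scaler_sumr.
apply: eq_bigr => J _; rewrite -(piM repH) -(piZ repH).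
apply/eqP; rewrite -subr_eq0 -(piB repH); apply/eqP.
apply: (ann_vJ q0 sqE relH genH repH (J := J)); last exact: PP.
by rewrite mulrBl -mulrA -scalerAl -!entry_factor // T_entry // subrr.
Qed.

Lemma entry_comp phi psi K J : isS T phi -> isS T psi ->
  entry (fun x => phi (psi x)) K J =
  (\sum_L left_factor L (entry phi K L) * left_factor J (entry psi L J)) * vJ J.
Proof.
move=> pS sS; have xM : inM T (psi (eJ J (vJ J))) by case: sS => h _ _; apply/h/inM_eJ1.
have [y hy] := fun_choice xM.
rewrite /entry (isS_entry K pS xM hy) mulr_suml; apply: eq_bigr => L _.
by rewrite entry_factor // -mulrA -hy -/(entry psi L J) -mulrA -entry_factor.
Qed.

Lemma inP_single J f : Defs.invariant J f -> inP (fun J' => if J' == J then f else 0 : L).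
Proof.
move=> fJ K; case: eqP => [->|_] // s _; exact: raddf0.
Qed.

(** The test vector is [f = pi (vJ J) g] in the summand [J]: there a left factor acts as the entry
    acts on [g], so equal actions give equal entries. *)
Lemma schur_act_faithful phi psi : isS T phi -> isS T psi ->
  (forall P, inP P -> schur_act phi P = schur_act psi P) ->
  forall x, inM T x -> phi x = psi x.
Proof.
move=> pS sS h; have E K J : entry phi K J = entry psi K J.
  rewrite entry_factor // [RHS]entry_factor //; apply/eqP; rewrite -subr_eq0 -mulrBl; apply/eqP.
  apply: (pi_faithful q0 sqE relH genH repH) => g; rewrite (piM repH) (piB repH).
  set f := pi _ g.
  have fJ : Defs.invariant J f by apply: (vJ_inv q0 sqE relH repH).
  have := congr1 (fun F : PF m k => F K) (h _ (inP_single fJ)).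
  have single chi : schur_act chi (fun J' => if J' == J then f else 0) K
      = pi (left_factor J (entry chi K J)) f.
    rewrite /schur_act (bigD1 J) //= eqxx big1 ?addr0 // => J' /negbTE->.
    exact: (pi0r repH).
  by rewrite !single => ->; rewrite subrr.
move=> x xM; apply: functional_extensionality => K.
have [y hy] := fun_choice xM.
rewrite (isS_entry K pS xM hy) (isS_entry K sS xM hy).
by apply: eq_bigr => J _; rewrite E.
Qed.

(** By [sum_dcoset] the sum of the [T_a T_d] is a left factor of the entry at [(K, J)]; all other
    entries vanish. *)
Lemma schur_act_basis K J d phi P : Dcos K J d -> is_b q T X Xi sq K J d phi -> inP P ->
  schur_act phi P = rho_b q T X Xi sq pi K J d P.
Proof.
move=> dKJ [bJ b0] PP.
rewrite (@schur_actE _ (fun K' J' => if (K' == K) && (J' == J) then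
   \sum_(a in WK K | pb (Dmin K (KdJ K J d) a)) Tfin T a * Taff q T X Xi sq d else 0)) //.
  apply: functional_extensionality => K'; rewrite /rho_b.
  case: (K' =P K) => [_|_] /=; last by rewrite big1 // => J' _; rewrite (pi0 repH).
  rewrite (bigD1 J) //= eqxx (pi_sum repH) [X in _ + X]big1 ?addr0 // => J' /negbTE->.
  exact: (pi0 repH).
move=> K' J'; rewrite /entry; have [->|nJ] := eqVneq J' J.
  rewrite bJ /eJ (sum_dcoset q0 sqE relH dKJ) andbT.
  by case: eqP => _ //; rewrite mul0r.
by rewrite b0 // andbF mul0r.
Qed.

End SchurAction.

Theorem theorem4p8 (m : nat) (k : closedFieldType) (p f q : nat) (sq : k)
    (H : algType k) (T : 'I_m.+1 -> H) (X Xi : 'I_m.+2 -> H)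
    (pi : H -> Laur m k -> Laur m k) :
  prime p -> (0 < f)%N -> q = (p ^ f)%N ->
  (p%:R : k) != 0 -> (q%:R : k) != 1 -> sq ^+ 2 = q%:R ->
  hecke_rels q T X Xi -> hecke_generated T X Xi -> hecke_universal q T X Xi ->
  polyrep q T X Xi pi ->
  exists rho : (Fam m H -> Fam m H) -> PF m k -> PF m k,
    (* rho(phi) is a k-linear endomorphism of P(S) *)
    (forall phi, isS T phi -> forall P, inP P -> inP (rho phi P)) /\
    (forall phi, isS T phi -> forall (a : k) P P', inP P -> inP P' ->
       rho phi (fun K => a *: P K + P' K) = (fun K => a *: rho phi P K + rho phi P' K)) /\
    (* rho is well defined on S (elements of S are maps on oplus_J v_J H) *)
    (forall phi psi, isS T phi -> isS T psi ->
       (forall x, inM T x -> phi x = psi x) ->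
       forall P, inP P -> rho phi P = rho psi P) /\
    (* rho is k-linear *)
    (forall (a : k) phi psi, isS T phi -> isS T psi -> forall P, inP P ->
       rho (fun x K => a *: phi x K + psi x K) P
       = (fun K => a *: rho phi P K + rho psi P K)) /\
    (* rho is multiplicative and unital *)
    (forall phi psi, isS T phi -> isS T psi -> forall P, inP P ->
       rho (fun x => phi (psi x)) P = rho phi (rho psi P)) /\
    (forall P, inP P -> rho (fun x => x) P = P) /\
    (* rho is faithful *)
    (forall phi psi, isS T phi -> isS T psi ->
       (forall P, inP P -> rho phi P = rho psi P) ->
       forall x, inM T x -> phi x = psi x) /\
    (* action of the basis elements b^d_{K,J}, d in D_{K,J} *)
    (forall (K J : {set 'I_m.+1}) (d : Wt m), Dcos K J d ->
       forall phi, isS T phi -> is_b q T X Xi sq K J d phi ->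
       forall P, inP P -> rho phi P = rho_b q T X Xi sq pi K J d P).
Proof.
move=> _ _ qE p0 _ sqE relH genH _ repH.
have q0 : (q%:R : k) != 0 by rewrite qE natrX expf_neq0.
exists (schur_act T pi); do 7?split.
- by move=> phi pS P; apply: (schur_act_inv q0 sqE relH genH repH).
- move=> phi pS a P P' _ _; apply: functional_extensionality => K.
  rewrite /schur_act scaler_sumr -big_split; apply: eq_bigr => J _.
  exact: (piR repH).
- move=> phi psi pS sS h P _; apply: functional_extensionality => K.
  by apply: eq_bigr => J _; rewrite /entry h //; apply: inM_eJ1.
- move=> a phi psi pS sS P PP.
  rewrite (schur_actE q0 sqE relH genH repH (c := fun K J =>
     a *: left_factor T J (entry T phi K J) + left_factor T J (entry T psi K J))) //.
    apply: functional_extensionality => K; rewrite /schur_act scaler_sumr -big_split.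
    by apply: eq_bigr => J _; rewrite (piL repH).
  move=> K J; rewrite mulrDl -scalerAl.
  by rewrite -!(entry_factor q0 sqE relH genH repH).
- move=> phi psi pS sS P PP.
  (* The products of left factors are themselves left factors of the composite, so [schur_actE]
     reduces multiplicativity to matrix multiplication. *)
  have hc K J := entry_comp q0 sqE relH genH repH K J pS sS.
  rewrite (schur_actE q0 sqE relH genH repH hc PP).
  apply: functional_extensionality => K; rewrite /schur_act.
  under eq_bigr => J _ do rewrite (pi_sum repH).
  rewrite exchange_big; apply: eq_bigr => M _ /=.
  rewrite (big_morph (pi _) (piDr repH _) (pi0r repH _)).
  by apply: eq_bigr => J _; rewrite (piM repH).
- move=> P PP.
  rewrite (schur_actE q0 sqE relH genH repH (c := fun K J => if J == K then 1 else 0)) //.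
    apply: functional_extensionality => K; rewrite (bigD1 K) //= eqxx (pi1 repH).
    by rewrite big1 ?addr0 // => J /negbTE->; rewrite (pi0 repH).
  by move=> K J; rewrite /entry /eJ eq_sym; case: eqP => _; rewrite ?mul1r ?mul0r.
- by move=> phi psi pS sS; apply: (schur_act_faithful q0 sqE relH genH repH).
- by move=> K J d dKJ phi _ hb P; apply: (schur_act_basis q0 sqE relH genH repH).
Qed.
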